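(* Let $n\ge 1$ and let $v:\mathbb{R}^n\to\mathbb{R}^n$ be a unit Lipschitz vector field with Lipschitz constant $K>0$. For each $1\le p<\infty$ and every $F\in L^p(\mathbb{R}^n)$, the averages $$M_t(F)(X)=\frac{1}{2t}\int_{-t}^{t}F\big[X+\beta\,v(X)\big]\,d\beta ,\qquad 0<t<1/K,$$ satisfy $$\lim_{t\to0}\|M_t(F)-F\|_p=0 .$$
   Context: A unit Lipschitz vector field on $\mathbb{R}^n$ with Lipschitz constant $K$ is a map $v:\mathbb{R}^n\to\mathbb{R}^n$ with $\|v(X)\|_2=1$ for all $X$ and $\|v(X)-v(Y)\|\le K\|X-Y\|$ for all $X,Y$. $L^p$ spaces are with respect to Lebesgue measure on $\mathbb{R}^n$. *)

(* Defs.v *)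
From HB Require Import structures.
From mathcomp Require Import all_boot all_order all_algebra.
From mathcomp Require Import all_classical all_reals all_analysis.

Set Implicit Arguments.
Unset Strict Implicit.
Unset Printing Implicit Defensive.
Import Order.TTheory GRing.Theory Num.Theory.
Import numFieldNormedType.Exports.

Local Open Scope classical_set_scope.
Local Open Scope ring_scope.

(* The norm that the library puts on ['rV[R]_n] is the max norm. *)
Definition l2norm (R : realType) (n : nat) (x : 'rV[R]_n) : R :=
  Num.sqrt (\sum_(i < n) x 0 i ^+ 2).

Definition unit_lipschitz_field (R : realType) (n : nat) (K : R)
    (v : 'rV[R]_n -> 'rV[R]_n) : Prop :=
  (forall X, l2norm (v X) = 1) /\
  (forall X Y, l2norm (v X - v Y) <= K * l2norm (X - Y)).

Section lebesgue_measure_on_rV.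
Context {R : realType} (n : nat).
Local Open Scope ereal_scope.

Definition box (a b : 'rV[R]_n) : set 'rV[R]_n :=
  [set x | forall i, (a 0%R i < x 0%R i <= b 0%R i)%R].

Definition box_vol (a b : 'rV[R]_n) : R :=
  (\prod_(i < n) Num.max 0 (b 0 i - a 0 i))%R.

Lemma box_vol_ge0 a b : (0 <= box_vol a b)%R.
Proof. by apply: prodr_ge0 => i _; rewrite le_max lexx. Qed.

(* The boxes of a cover are indexed by a set [c.1] of natural numbers so that
   finite families, the empty one included, are allowed. *)
Definition box_cover (A : set 'rV[R]_n)
    (c : set nat * (nat -> 'rV[R]_n * 'rV[R]_n)) : Prop :=
  A `<=` \bigcup_(k in c.1) box (c.2 k).1 (c.2 k).2.

Definition cover_vol (c : set nat * (nat -> 'rV[R]_n * 'rV[R]_n)) : \bar R :=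
  \esum_(k in c.1) (box_vol (c.2 k).1 (c.2 k).2)%:E.

Definition lebesgue_outer (A : set 'rV[R]_n) : \bar R :=
  ereal_inf [set cover_vol c | c in box_cover A].

Lemma cover_vol_ge0 c : 0 <= cover_vol c.
Proof. by apply: esum_ge0 => k _; rewrite lee_fin box_vol_ge0. Qed.

Lemma lebesgue_outer_ge0 A : 0 <= lebesgue_outer A.
Proof. by apply: le_ereal_inf_tmp => _ [c _ <-]; exact: cover_vol_ge0. Qed.

Lemma lebesgue_outer0 : lebesgue_outer set0 = 0.
Proof.
apply/eqP; rewrite eq_le lebesgue_outer_ge0 andbT.
apply: ereal_inf_lbound; exists (set0, fun=> (0%R, 0%R)); first by move=> x.
by rewrite /cover_vol /= esum_set0.
Qed.

Lemma le_lebesgue_outer : {homo lebesgue_outer : A B / A `<=` B >-> A <= B}.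
Proof.
move=> A B AB; apply/ereal_inf_le_tmp => _ [c Bc <-]; exists c => //.
exact: subset_trans AB Bc.
Qed.

Lemma lebesgue_outer_sigma_subadditive : sigma_subadditive lebesgue_outer.
Proof.
move=> A; have [[i ioo]|] := pselect (exists i, lebesgue_outer (A i) = +oo).
  rewrite (eseries_pinfty _ _ ioo) ?leey// => k _.
  by rewrite -ltNye (lt_le_trans _ (lebesgue_outer_ge0 _)).
rewrite -forallNE => Aoo; apply/lee_addgt0Pr => _/posnumP[e].
rewrite (le_trans _ (epsilon_trick _ _ _))//; last first.
  by move=> k; exact: lebesgue_outer_ge0.
pose P k c := box_cover (A k) c /\
  cover_vol c <= lebesgue_outer (A k) + (e%:num / (2 ^ k.+1)%:R)%:E.
have [G PG] : {G & forall k, P k (G k)}.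
  apply: (@choice _ _ P) => k.
  have Afin : lebesgue_outer (A k) \is a fin_num.
    by rewrite ge0_fin_numE ?lebesgue_outer_ge0// ltey; apply/eqP/Aoo.
  have ek : (0 < e%:num / (2 ^ k.+1)%:R)%R by [].
  have [_ [c Ac <-] /ltW cA] := lb_ereal_inf_adherent ek Afin.
  by exists c.
have /card_esym/ppcard_eqP[f] := card_nat2.
pose J : set (nat * nat) := [set: nat] `*`` (fun k => (G k).1).
pose g j : 'rV[R]_n * 'rV[R]_n := let ij := f j in (G ij.1).2 ij.2.
pose D : set nat := f @^-1` J.
have gJ : cover_vol (D, g) =
    \esum_(i in [set: nat]) \esum_(j in (G i).1)
      (box_vol ((G i).2 j).1 ((G i).2 j).2)%:E.
  rewrite esum_esum; last by move=> i j _ _; rewrite lee_fin box_vol_ge0.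
  rewrite (@reindex_esum _ _ _ D J f)//; split=> [//|x y _ _ fxy|x Jx].
    by apply: (inj (f := f)); rewrite ?inE.
  by exists (f^-1%FUN x); rewrite /D /preimage /= ?invK ?inE.
apply: (@le_trans _ _ (cover_vol (D, g))).
  apply: ereal_inf_lbound; exists (D, g) => // x [i _ Aix].
  have [j Gj xj] := (PG i).1 x Aix.
  exists (f^-1%FUN (i, j)); first by rewrite /D /J /= invK ?inE.
  by rewrite /g /= invK ?inE.
rewrite gJ nneseries_esumT; last first.
  by move=> k; rewrite adde_ge0 ?lebesgue_outer_ge0.
by apply: le_esum => k _; exact: (PG k).2.
Qed.

HB.instance Definition _ := isOuterMeasure.Build R 'rV[R]_n lebesgue_outer
  lebesgue_outer0 lebesgue_outer_ge0 le_lebesgue_outer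
  lebesgue_outer_sigma_subadditive.

(* Caratheodory's sigma-algebra of [lebesgue_outer] consists of all Lebesgue
   measurable sets; in particular the measure is complete. *)
Definition lebesgue_measure_rV :
  set (caratheodory_type lebesgue_outer) -> \bar R := lebesgue_outer.

Let mu0 : lebesgue_measure_rV set0 = 0.
Proof. exact: lebesgue_outer0. Qed.

Let mu_ge0 A : 0 <= lebesgue_measure_rV A.
Proof. exact: lebesgue_outer_ge0. Qed.

Let mu_sigma_additive : semi_sigma_additive lebesgue_measure_rV.
Proof. exact: caratheodory_measure_sigma_additive. Qed.

HB.instance Definition _ := isMeasure.Build _ _ _ lebesgue_measure_rV
  mu0 mu_ge0 mu_sigma_additive.

End lebesgue_measure_on_rV.
Arguments lebesgue_measure_rV {R} n.

(* The average $M_t(F)(X)$. The completed measure is used since the restriction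
   of a Lebesgue measurable [F] to a line need not be Borel, even for almost
   every line. *)
Definition directional_mean (R : realType) (n : nat)
    (v : 'rV[R]_n -> 'rV[R]_n) (t : R) (F : 'rV[R]_n -> R)
    (X : 'rV[R]_n) : R :=
  (2 * t)^-1 *
    \int[completed_lebesgue_measure]_(beta in `[- t, t]) F (X + beta *: v X).

(* Main.v *)
Require Import Defs.
From HB Require Import structures.
From mathcomp Require Import all_boot all_order all_algebra.
From mathcomp Require Import all_classical all_reals all_analysis.
From mathcomp Require Import measurable_realfun ring lra.

(** For [|b| K < 1] the map [phi_b X = X + b v(X)] expands distances by a factor
    at least [1 - |b| K], so [|phi_b^-1 A| <= C |A|] where [C] depends only on
    [n] and on a bound for [|b| K]; a crude [C], from covering by cubes, is
    enough and spares the Jacobian. Composition with [phi_b] is thus bounded on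
    L^p uniformly in small [b]; since [A] and [phi_b^-1 A] differ little in
    measure when [A] is a box, it converges strongly to the identity of L^p as
    [b -> 0]. By Jensen's inequality and Tonelli's theorem, [||M_t F - F||_p^p]
    is at most the average over [|b| <= t] of [||F o phi_b - F||_p^p], and
    [||M_t F||_p^p] at most that of [||F o phi_b||_p^p].

    Tonelli's theorem needs [F (X + b v(X))] jointly measurable in [X] and [b],
    which is clear for Borel [F] only; a Lebesgue measurable [F] is Borel off a
    null Borel set [N], and for almost every [X] almost every point of the
    segment through [X] avoids [N]. *)

Set Implicit Arguments.
Unset Strict Implicit.
Unset Printing Implicit Defensive.
Import Order.TTheory GRing.Theory Num.Theory.
Import numFieldNormedType.Exports.

Local Open Scope classical_set_scope.
Local Open Scope ring_scope.

(** * The Euclidean norm and the outer measure *)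

(** The inequality |a - b|^p <= |a^p - b^p| for a, b >= 0 brings the strong convergence down from
    L^p to L^1. There simple functions are dense, and for them everything depends on the measure of
    the set of points that enter or leave a level set. The bound on preimages is proved for the
    outer measure of arbitrary sets, before phi_b is known to be measurable: it makes preimages of
    null sets null, and this is what makes phi_b measurable for the Lebesgue sets. Strong
    convergence works with |b| <= 1/(2K), where one constant serves all b. The means for a given t <
    1/K are bounded with the constant attached to that t, which blows up as t approaches 1/K. *)

Section l2norm.
Context {R : realType} {n : nat}.
Implicit Types x y : 'rV[R]_n.

Let ssq x : R := \sum_(i < n) x 0 i ^+ 2.

Let ssq_ge0 x : 0 <= ssq x.
Proof. by apply: sumr_ge0 => i _; rewrite sqr_ge0. Qed.

Lemma l2norm_ge0 x : 0 <= l2norm x.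
Proof. exact: sqrtr_ge0. Qed.

Let sqr_l2norm x : l2norm x ^+ 2 = ssq x.
Proof. by rewrite sqr_sqrtr// ssq_ge0. Qed.

Lemma coord_le_l2norm x i : `|x 0 i| <= l2norm x.
Proof.
rewrite -ler_sqr ?nnegrE ?l2norm_ge0 ?normr_ge0// sqr_l2norm real_normK ?num_real//.
by rewrite /ssq (bigD1 i)//= lerDl sumr_ge0// => j _; rewrite sqr_ge0.
Qed.

Lemma l2norm_le_coord x (d : R) : (forall i, `|x 0 i| <= d) ->
  l2norm x <= n%:R * d.
Proof.
move=> xd; have [n0|/card_gt0P[i _]] := posnP #|'I_n|.
  rewrite /l2norm big1 ?sqrtr0 => [|i]; last by have := card0_eq n0 i.
  by rewrite -(card_ord n) n0 mul0r.
have d0 : 0 <= d by rewrite (le_trans _ (xd i)).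
have n0 : 0 <= n%:R :> R by [].
rewrite -ler_sqr ?nnegrE ?l2norm_ge0 ?mulr_ge0// sqr_l2norm.
rewrite (@le_trans _ _ (n%:R * d ^+ 2))//.
  rewrite mulr_natl -[X in _ *+ X]card_ord -sumr_const ler_sum// => j _.
  by rewrite -real_normK ?num_real// ler_sqr// nnegrE.
rewrite exprMn ler_wpM2r ?sqr_ge0// expr2 ler_peMl// ler1n.
by case: (n) i => // -[].
Qed.

(** Cauchy-Schwarz: with [s] the inner product, the sum of the squares of the coordinates of
    [b x - a y] equals [2 a b (a b - s)] and is nonnegative. If [a b = 0], one of the vectors
    vanishes. *)
Let dot_le x y : \sum_(i < n) x 0 i * y 0 i <= l2norm x * l2norm y.
Proof.
set a := l2norm x; set b := l2norm y; set s := \sum_(i < n) _.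
have a0 : 0 <= a := l2norm_ge0 x.
have b0 : 0 <= b := l2norm_ge0 y.
have : 0 <= \sum_(i < n) (b * x 0 i - a * y 0 i) ^+ 2.
  by apply: sumr_ge0 => i _; rewrite sqr_ge0.
have -> : \sum_(i < n) (b * x 0 i - a * y 0 i) ^+ 2 =
    b ^+ 2 * ssq x - 2 * (a * b) * s + a ^+ 2 * ssq y.
  rewrite /ssq /s !mulr_sumr -sumrB -big_split/=.
  by apply: eq_bigr => i _; ring.
rewrite -!sqr_l2norm -/a -/b => abs.
have [ab0|] := ltrP 0 (a * b).
  rewrite -(ler_pM2l ab0); nra.
rewrite le_eqVlt ltNge mulr_ge0// orbF => /eqP ab0; rewrite ab0.
have [x0|y0] : (forall i, x 0 i = 0) \/ (forall i, y 0 i = 0).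
- move/eqP : ab0; rewrite mulf_eq0 => /orP[] /eqP z0; [left|right] => i.
    by apply/eqP; rewrite -normr_le0 -z0 coord_le_l2norm.
  by apply/eqP; rewrite -normr_le0 -z0 coord_le_l2norm.
- by rewrite /s big1// => i _; rewrite x0 mul0r.
- by rewrite /s big1// => i _; rewrite y0 mulr0.
Qed.

Lemma l2norm_triangle x y : l2norm (x + y) <= l2norm x + l2norm y.
Proof.
rewrite -ler_sqr ?nnegrE ?addr_ge0 ?l2norm_ge0//.
rewrite sqrrD !sqr_l2norm.
have -> : ssq (x + y) = ssq x + 2 * (\sum_(i < n) x 0 i * y 0 i) + ssq y.
  rewrite /ssq mulr_sumr -!big_split/=.
  by apply: eq_bigr => i _; rewrite mxE; ring.
by rewrite lerD2r lerD2l mulr_natl lerMn2r orbC dot_le.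
Qed.

Lemma l2normZ (a : R) x : l2norm (a *: x) = `|a| * l2norm x.
Proof.
rewrite /l2norm -sqrtr_sqr -sqrtrM ?sqr_ge0//; congr Num.sqrt.
by rewrite mulr_sumr; apply: eq_bigr => i _; rewrite mxE exprMn.
Qed.

End l2norm.

Section outer_measure_countable.
Context {R : realType} {n : nat}.
Implicit Types A : set 'rV[R]_n.
Local Notation mu := (@lebesgue_outer R n).
Local Open Scope ereal_scope.

Lemma lebesgue_outer_box_le (a b : 'rV[R]_n) : mu (box a b) <= (box_vol a b)%:E.
Proof.
apply: ge_ereal_inf; exists ((box_vol a b)%:E) => //.
exists ([set 0%N], fun=> (a, b)); first by move=> x xab; exists 0%N.
by rewrite /cover_vol /= esum_set1// lee_fin box_vol_ge0.
Qed.

Lemma lebesgue_outer_cover (I : finType) (P : pred I) (B : I -> set 'rV[R]_n) A :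
  (forall x, A x -> exists2 i, P i & B i x) -> mu A <= \sum_(i | P i) mu (B i).
Proof.
move=> AB; apply: (@le_trans _ _ (mu (\big[setU/set0]_(i | P i) B i))).
  apply: le_lebesgue_outer => x /AB[i Pi Bix].
  by rewrite (bigD1 i)//=; left.
elim/big_rec2 : _ => [|i y S _ Sy]; first by rewrite lebesgue_outer0.
by rewrite (le_trans (outer_measureU2 _ _ _))// leeD2l.
Qed.

Lemma lebesgue_outer_bigcup (D : set nat) (B : nat -> set 'rV[R]_n) :
  mu (\bigcup_(k in D) B k) <= \esum_(k in D) mu (B k).
Proof.
rewrite bigcup_mkcond esum_mkcond -nneseries_esumT => [|k]; last first.
  by case: ifP => // _; exact: lebesgue_outer_ge0.
apply: (le_trans (lebesgue_outer_sigma_subadditive _)).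
apply: lee_nneseries => k _; first by rewrite lebesgue_outer_ge0.
by case: ifP => // _; rewrite lebesgue_outer0.
Qed.

End outer_measure_countable.

(** * Preimages under maps with Lipschitz inverse *)

Section inverse_lipschitz.
Context {R : realType} {n : nat}.
Variables (L : R) (phi : 'rV[R]_n -> 'rV[R]_n).
Hypothesis L_gt0 : 0 < L.
Hypothesis phiL : forall X Y : 'rV[R]_n, l2norm (X - Y) <= L * l2norm (phi X - phi Y).
Local Notation mu := (@lebesgue_outer R n).

(* Crude version of the optimal constant [L ^+ n]; only its dependence on [n]
   and [L] alone matters. *)
Definition distortion : R := 2 * (L * n.+1%:R).

Lemma distortion_gt0 : 0 < distortion.
Proof. by rewrite /distortion !mulr_gt0. Qed.

(** The points of [A] lie within Euclidean distance [L * n * s] of any one of them, so a cube about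
    one point contains [A]. *)
Let preimage_cube (A : set 'rV[R]_n) (s : R) : 0 < s ->
  (forall X Y, A X -> A Y -> forall i, `|phi X 0 i - phi Y 0 i| <= s) ->
  (mu A <= ((distortion * s) ^+ n)%:E)%E.
Proof.
move=> s0 As; have [->|/set0P[Y AY]] := eqVneq A set0.
  by rewrite lebesgue_outer0 lee_fin exprn_ge0// mulr_ge0 ?ltW ?distortion_gt0.
(* [n.+1] in place of [n] makes the coordinate bound strict, as the open side of a box requires. *)
pose d := L * (n.+1%:R * s).
have d0 : 0 < d by rewrite !mulr_gt0.
apply: (@le_trans _ _ (mu (box (Y - const_mx d) (Y + const_mx d)))).
  apply: le_lebesgue_outer => X AX i; rewrite !mxE.
  have : `|X 0 i - Y 0 i| < d.
    have := coord_le_l2norm (X - Y) i; rewrite !mxE => /le_lt_trans; apply.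
    apply: (le_lt_trans (phiL X Y)); rewrite ltr_pM2l//.
    apply: (@le_lt_trans _ _ (n%:R * s)); last by rewrite ltr_pM2r// ltr_nat.
    by apply: l2norm_le_coord => j; rewrite !mxE; exact: As.
  by rewrite ltr_norml => /andP[? ?]; lra.
apply: (le_trans (lebesgue_outer_box_le _ _)); rewrite lee_fin /box_vol.
rewrite -[n in X in _ <= X]card_ord -prodr_const ler_prod// => i _.
rewrite !mxE le_max lexx/= ge_max /distortion.
apply/andP; split; first by rewrite !mulr_ge0// ltW.
by rewrite [leLHS](_ : _ = 2 * d); [rewrite /d !mulrA|ring].
Qed.

(* A grid of cubes of side [s]: the preimage of each cube has small diameter,
   whereas that of an elongated box need not. *)
Let preimage_box_approx (a b : 'rV[R]_n) (s : R) : 0 < s ->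
  (forall i, a 0 i < b 0 i) ->
  (mu (phi @^-1` box a b) <=
   (distortion ^+ n * \prod_(i < n) (b 0 i - a 0 i + s))%:E)%E.
Proof.
move=> s0 ab.
(* [m i] cubes cover the [i]-th side with an overshoot of at most [s]. The common bound [M] turns
   multi-indices into functions on one finite type, and [Q] cuts the [i]-th index back to [m i]
   values, so that the sum over [P] factors. *)
pose m i := (Num.truncn ((b 0 i - a 0 i) / s)).+1.
pose M := (\max_i m i)%N.
pose Q i (j : 'I_M) := (j < m i)%N.
pose P (f : {ffun 'I_n -> 'I_M}) := f \in family Q.
pose B (f : {ffun 'I_n -> 'I_M}) := [set X | forall i,
  (f i)%:R * s <= phi X 0 i - a 0 i <= (f i)%:R * s + s].
have cover X : (phi @^-1` box a b) X -> exists2 f, P f & B f X.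
  move=> Xab; pose k i := Num.truncn ((phi X 0 i - a 0 i) / s).
  have q0 i : 0 <= (phi X 0 i - a 0 i) / s.
    by have /andP[? _] := Xab i; rewrite divr_ge0 ?subr_ge0 ?ltW.
  have km i : (k i < m i)%N.
    rewrite ltnS le_truncn// ler_pM2r ?invr_gt0// lerD2r.
    by have /andP[] := Xab i.
  have kM i : (k i < M)%N by rewrite (leq_trans (km i))// (leq_bigmax i).
  exists [ffun i => Ordinal (kM i)].
    by apply/familyP => i; rewrite ffunE /=; exact: km.
  move=> i; rewrite ffunE/=.
  have /andP[h1 h2] := Num.Theory.truncn_itv (q0 i).
  move: h1 h2; rewrite -/(k i) ler_pdivlMr// ltr_pdivrMr// => -> /ltW/=.
  by rewrite -natr1 mulrDl mul1r.
apply: (le_trans (lebesgue_outer_cover cover)).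
apply: (@le_trans _ _ (\sum_(f | P f) ((distortion * s) ^+ n)%:E)%E).
  apply: lee_sum => f _; apply: preimage_cube => // X Y BX BY i.
  have /andP[? ?] := BX i; have /andP[? ?] := BY i.
  by rewrite ler_norml; lra.
rewrite sumEFin lee_fin.
have -> : \sum_(f | P f) (distortion * s) ^+ n =
    \prod_i \sum_(j | Q i j) (distortion * s).
  rewrite bigA_distr_big_dep; apply: eq_bigr => f _.
  by rewrite prodr_const card_ord.
rewrite -[n in distortion ^+ n]card_ord -prodr_const -big_split/=.
have D0 := distortion_gt0.
apply: ler_prod => i _; apply/andP; split.
  by apply: sumr_ge0 => j _; rewrite mulr_ge0// ltW.
have mM : (m i <= M)%N by rewrite (leq_bigmax i).
rewrite /Q (big_ord_narrow mM)/= sumr_const card_ord -mulr_natr -mulrA ler_pM2l//.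
have : (Num.truncn ((b 0 i - a 0 i) / s))%:R * s <= b 0 i - a 0 i.
  by rewrite -ler_pdivlMr// truncn_le// divr_ge0 ?subr_ge0 ?ltW.
by rewrite mulrC /m -natr1 mulrDr mulr1 lerD2r.
Qed.

(** Let the side [s] of the grid tend to 0: the product in the bound is a polynomial in [s], hence
    continuous at 0. *)
Lemma lebesgue_outer_preimage_box (a b : 'rV[R]_n) :
  (mu (phi @^-1` box a b) <= (distortion ^+ n * box_vol a b)%:E)%E.
Proof.
have D0 := distortion_gt0.
have [ab|] := pselect (forall i, a 0 i < b 0 i); last first.
  move=> /existsNP[i /negP]; rewrite -leNgt => ba.
  rewrite (_ : _ @^-1` _ = set0) ?lebesgue_outer0 ?lee_fin.
    by rewrite mulr_ge0 ?box_vol_ge0 ?exprn_ge0 // ltW.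
  by rewrite -subset0 => X /(_ i)/andP[aX /(lt_le_trans aX)]; rewrite ltNge ba.
pose q : {poly R} := \prod_(i < n) ('X + (b 0 i - a 0 i)%:P).
have qE s : \prod_(i < n) (b 0 i - a 0 i + s) = q.[s].
  rewrite horner_prod; apply: eq_bigr => i _.
  by rewrite hornerD hornerX hornerC addrC.
have -> : box_vol a b = q.[0].
  rewrite -qE; apply: eq_bigr => i _; rewrite addr0; apply/max_idPr.
  by rewrite subr_ge0 ltW.
apply/lee_addgt0Pr => e e0.
have De : 0 < e / distortion ^+ n by rewrite divr_gt0// exprn_gt0.
have /cvgrPdist_lt/(_ _ De) := @continuous_horner R q 0.
case=> d /= d0 /(_ (d / 2)); rewrite /= sub0r normrN gtr0_norm ?divr_gt0//.
rewrite ltr_pdivrMr// ltr_pMr// ltr1n => /(_ isT).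
rewrite ltr_norml => /andP[qd _].
apply: (le_trans (preimage_box_approx (s := d / 2) _ ab)).
  by rewrite divr_gt0.
rewrite -EFinD lee_fin qE.
suff : distortion ^+ n * q.[d / 2] <=
  distortion ^+ n * (q.[0] + e / distortion ^+ n).
  move=> /le_trans; apply; rewrite mulrDr.
  by rewrite lerD2l mulrCA divff ?mulr1// gt_eqF// exprn_gt0.
by rewrite ler_pM2l ?exprn_gt0//; lra.
Qed.

(** The preimages of the boxes of a cover of [A] cover the preimage of [A], so the bound for boxes
    passes to the infimum over covers. *)
Lemma lebesgue_outer_preimage (A : set 'rV[R]_n) :
  (mu (phi @^-1` A) <= (distortion ^+ n)%:E * mu A)%E.
Proof.
have D0 : 0 < distortion ^+ n by rewrite exprn_gt0// distortion_gt0.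
rewrite -lee_pdivrMl//; apply: le_ereal_inf_tmp => _ [[D g] Dg <-].
rewrite lee_pdivrMl//.
apply: (@le_trans _ _ (mu (\bigcup_(k in D) phi @^-1` box (g k).1 (g k).2))).
  by apply: le_lebesgue_outer => X /Dg.
apply: (le_trans (lebesgue_outer_bigcup _ _)).
rewrite /cover_vol/=.
apply: (@le_trans _ _ (\esum_(k in D)
    (distortion ^+ n)%:E * (box_vol (g k).1 (g k).2)%:E)%E).
  by apply: le_esum => k _; rewrite -EFinM lebesgue_outer_preimage_box.
rewrite !(esum_mkcond D) -!nneseries_esumT => [|k|k]; last 2 first.
- by case: ifP => // _; rewrite lee_fin box_vol_ge0.
- by case: ifP => // _; rewrite -EFinM lee_fin mulr_ge0 ?box_vol_ge0 ?ltW.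
rewrite -nneseriesZl; last first.
  by move=> k _; case: ifP => // _; rewrite lee_fin box_vol_ge0.
by apply: lee_nneseries => k _; case: ifP => // _;
   rewrite ?mule0// -EFinM lee_fin mulr_ge0 ?box_vol_ge0 ?ltW.
Qed.

End inverse_lipschitz.

(** * Lebesgue measurable sets and Borel hulls *)

Notation lebesgue_rV R n := (caratheodory_type (@lebesgue_outer R n)).

Section lebesgue_measurable_sets.
Context {R : realType} {n : nat}.
Local Notation mu := (@lebesgue_outer R n).
Local Notation rVL := (lebesgue_rV R n).

(** Caratheodory's criterion: cutting each box of a cover along the hyperplane gives covers of the
    two parts of the test set with the same total volume. *)
Lemma measurable_halfspace (i : 'I_n) (c : R) :
  measurable ([set x | x 0 i <= c] : set rVL).
Proof.
apply: le_caratheodory_measurable => A /=.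
apply: le_ereal_inf_tmp => _ [[D g] Dg <-].
pose up (b : 'rV[R]_n) := \row_j (if j == i then Num.min (b 0 j) c else b 0 j).
pose lo (a : 'rV[R]_n) := \row_j (if j == i then Num.max (a 0 j) c else a 0 j).
(* The [max 0] in [box_vol] makes this additive for empty boxes too. *)
have volD a b : box_vol a b = box_vol a (up b) + box_vol (lo a) b.
  have split_i (f : 'I_n -> R) : \prod_j f j = f i * \prod_(j | j != i) f j.
    by rewrite (bigD1 i).
  rewrite /box_vol !split_i !mxE eqxx.
  have -> : \prod_(j < n | j != i) Num.max 0 (up b 0 j - a 0 j) =
      \prod_(j < n | j != i) Num.max 0 (b 0 j - a 0 j).
    by apply: eq_bigr => j /negbTE ji; rewrite mxE ji.
  have -> : \prod_(j < n | j != i) Num.max 0 (b 0 j - lo a 0 j) =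
      \prod_(j < n | j != i) Num.max 0 (b 0 j - a 0 j).
    by apply: eq_bigr => j /negbTE ji; rewrite mxE ji.
  rewrite -mulrDl; congr (_ * _).
  by case: (leP (a 0 i) c) => ?; case: (leP (b 0 i) c) => ?;
    do ![case: (leP 0 _) => ?]; lra.
rewrite /cover_vol /=.
under [leRHS]eq_esum do rewrite volD EFinD.
rewrite esumD; [|by move=> k _; rewrite lee_fin box_vol_ge0..].
apply: leeD.
- apply: ge_ereal_inf; eexists; last exact: lexx.
  exists (D, fun k => ((g k).1, up (g k).2)) => // x [/Dg[k Dk xk]] xc.
  exists k => // j; rewrite /= mxE; have /andP[-> xj] := xk j.
  by case: eqP => [ji|_//]; rewrite le_min xj ji.
- apply: ge_ereal_inf; eexists; last exact: lexx.
  exists (D, fun k => (lo (g k).1, (g k).2)) => // x [/Dg[k Dk xk]].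
  move=> /negP; rewrite -ltNge => xc.
  exists k => // j; rewrite /= mxE; have /andP[xj ->] := xk j.
  by rewrite andbT; case: eqP => [ji|_//]; rewrite gt_max xj ji.
Qed.

Lemma measurable_coord (i : 'I_n) :
  measurable_fun setT (fun x : rVL => x 0 i).
Proof.
apply: (measurability _ (RGenOInfty.measurableE R)) => _ [_ [c ->] <-].
rewrite setTI (_ : _ @^-1` _ = ~` [set x : rVL | x 0 i <= c]).
  by apply: measurableC; exact: measurable_halfspace.
by apply/seteqP; split => x /=; rewrite in_itv/= andbT ltNge => /negP.
Qed.

Lemma box_preimage (a b : 'rV[R]_n) : box a b =
  \bigcap_(i in [set: 'I_n]) (fun x : 'rV[R]_n => x 0 i) @^-1` `]a 0 i, b 0 i].
Proof.
apply/seteqP; split => [x xab i _|x xab i]; first by rewrite /= in_itv/= xab.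
by have := xab i I; rewrite /= in_itv.
Qed.

Lemma measurable_box (a b : 'rV[R]_n) : measurable (box a b : set rVL).
Proof.
rewrite box_preimage; apply: fin_bigcap_measurable => // i _.
by rewrite -[X in measurable X]setTI; exact: measurable_coord.
Qed.

Definition big_box (k : nat) : set 'rV[R]_n :=
  box (const_mx (- k%:R)) (const_mx k%:R).

Lemma bigcup_big_box : \bigcup_k big_box k = [set: 'rV[R]_n].
Proof.
apply/seteqP; split => // x _; exists (Num.truncn (l2norm x)).+1 => // i.
rewrite !mxE; have := le_lt_trans (coord_le_l2norm x i) (truncnS_gt _).
by rewrite ltr_norml => /andP[-> /ltW].
Qed.

Lemma lebesgue_outer_box_lty (a b : 'rV[R]_n) : (mu (box a b) < +oo)%E.
Proof. exact: le_lt_trans (lebesgue_outer_box_le a b) (ltry _). Qed.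

Lemma lebesgue_measure_rV_sigma_finite :
  sigma_finite [set: rVL] (lebesgue_measure_rV n).
Proof.
exists big_box; first by rewrite bigcup_big_box.
by move=> k; split; [exact: measurable_box|exact: lebesgue_outer_box_lty].
Qed.

HB.instance Definition _ := Measure_isSigmaFinite.Build _ _ _
  (@lebesgue_measure_rV R n) lebesgue_measure_rV_sigma_finite.

(** The set where [g > c] is the union of countably many cubes of rational centre and radius [1/m],
    namely those at whose centre [g] exceeds [c + L/m]; the Lipschitz bound keeps such a cube inside
    the set. *)
Lemma measurable_fun_sup_lipschitz (g : 'rV[R]_n -> R) (L : R) :
  0 < L ->
  (forall (x y : 'rV[R]_n) d, (forall i, `|x 0 i - y 0 i| <= d) -> `|g x - g y| <= L * d) ->
  measurable_fun setT (g : rVL -> R).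
Proof.
move=> L0 gL.
apply: (measurability _ (RGenOInfty.measurableE R)) => _ [_ [c ->] <-].
pose r (k : 'rV[rat]_n) : 'rV[R]_n := map_mx ratr k.
pose cube (k : 'rV[rat]_n * nat) : set rVL :=
  \bigcap_(i in [set: 'I_n]) (fun x : rVL => x 0 i) @^-1`
    `[r k.1 0 i - k.2.+1%:R^-1, r k.1 0 i + k.2.+1%:R^-1].
pose U k : set rVL := if c < g (r k.1) - L / k.2.+1%:R then cube k else set0.
have Ugt (x : 'rV[R]_n) : (\bigcup_k U k) x -> c < g x.
  case=> k _; rewrite /U; case: ifPn => // ck xk.
  have : `|g (r k.1) - g x| <= L / k.2.+1%:R.
    by apply: gL => i; rewrite ler_distlC; have := xk i I; rewrite /= in_itv.
  by rewrite ler_distlC => /andP[+ _]; exact: lt_le_trans.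
have gtU (x : 'rV[R]_n) : c < g x -> (\bigcup_k U k) x.
  (* [L / m.+1] must be spent twice, on going from [x] to the rational centre and on the margin in
     [U]; hence less than half of [g x - c]. *)
  move=> cgx; pose m := Num.truncn (2 * L / (g x - c)).
  have gxc : 0 < g x - c by rewrite subr_gt0.
  have Lm : L / m.+1%:R < (g x - c) / 2.
    rewrite ltr_pdivrMr// mulrAC ltr_pdivlMr// [ltRHS]mulrC -ltr_pdivrMr//.
    by rewrite [L * 2]mulrC truncnS_gt.
  have /choice[q qx] : forall i, exists q : rat,
      `|ratr q - x 0 i| <= m.+1%:R^-1.
    move=> i; have : x 0 i < x 0 i + m.+1%:R^-1 by rewrite ltrDl.
    move=> /rat_in_itvoo[q]; rewrite in_itv/= => /andP[xq qx]; exists q.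
    by rewrite ler_distl (ltW qx) andbT (le_trans _ (ltW xq))// gerBl.
  exists (\row_i q i, m) => //; rewrite /U ifT/=.
    by move=> i _; rewrite /= in_itv/= !mxE -ler_distlC; exact: qx.
  have : `|g (r (\row_i q i)) - g x| <= L / m.+1%:R.
    by apply: gL => i; rewrite !mxE.
  rewrite ler_norml /=; move: Lm; move: (L / m.+1%:R) => e ? /andP[? _]; lra.
rewrite setTI (_ : _ @^-1` _ = \bigcup_k U k).
  apply: countable_bigcupT_measurable => [|k]; first exact: countableP.
  rewrite /U; case: ifP => // _; apply: fin_bigcap_measurable => // i _.
  by rewrite -[X in measurable X]setTI; exact: measurable_coord.
apply/seteqP; split => x; rewrite /= in_itv/= andbT; first exact: gtU.
exact: Ugt.
Qed.

End lebesgue_measurable_sets.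

Section borel_hull.
Context {R : realType} {n : nat}.
Local Notation mu := (@lebesgue_outer R n).
Local Notation rVL := (lebesgue_rV R n).

Definition boxes : set (set 'rV[R]_n) := [set A | exists a b, A = box a b].

Lemma sub_boxes_measurable : <<s boxes >> `<=` (measurable : set (set rVL)).
Proof.
apply: smallest_sub; first exact: sigma_algebra_measurable.
by move=> _ [a [b ->]]; exact: measurable_box.
Qed.

Lemma sigma_boxes_bigcup (A : (set 'rV[R]_n)^nat) :
  (forall k, <<s boxes >> (A k)) -> <<s boxes >> (\bigcup_k A k).
Proof. exact: sigma_algebra_bigcup. Qed.

(** Intersect the unions of covers whose volumes come within [1/(k+1)] of the infimum. A set of
    infinite outer measure takes the whole space as its hull. *)
Lemma lebesgue_outer_hull (A : set 'rV[R]_n) :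
  exists2 G, <<s boxes >> G & A `<=` G /\ mu G = mu A.
Proof.
have [Aoo|Afin] := eqVneq (mu A) +oo%E.
  exists setT; first exact: (@measurableT _ (g_sigma_algebraType boxes)).
  by split => //; apply/eqP; rewrite Aoo -leye_eq -Aoo le_lebesgue_outer.
have {}Afin : mu A \is a fin_num.
  by rewrite ge0_fin_numE ?lebesgue_outer_ge0// ltey.
have /choice[c cA] : forall k : nat, exists c,
    box_cover A c /\ (cover_vol c <= mu A + (k.+1%:R^-1)%:E)%E.
  move=> k; have k0 : (0 : R) < k.+1%:R^-1 by rewrite invr_gt0.
  by have [_ [c Ac <-] /ltW cA] := lb_ereal_inf_adherent k0 Afin; exists c.
pose U k := \bigcup_(j in (c k).1) box ((c k).2 j).1 ((c k).2 j).2.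
exists (\bigcap_k U k).
  apply: (@bigcapT_measurable _ (g_sigma_algebraType boxes)) => k.
  apply: bigcup_measurable => j _; apply: sub_sigma_algebra.
  by eexists; eexists.
have AU : A `<=` \bigcap_k U k by move=> x Ax k _; exact: (cA k).1.
split => //; apply/eqP; rewrite eq_le; apply/andP; split; last first.
  exact: le_lebesgue_outer.
apply/lee_addgt0Pr => e e0.
pose k := Num.truncn e^-1.
have ke : k.+1%:R^-1 <= e by rewrite invf_ple ?posrE// ltW// truncnS_gt.
apply: (@le_trans _ _ (mu (U k))).
  by apply: le_lebesgue_outer => x; exact.
apply: (le_trans (lebesgue_outer_bigcup _ _)).
apply: (@le_trans _ _ (cover_vol (c k))).
  by apply: le_esum => j _; exact: lebesgue_outer_box_le.
by apply: (le_trans (cA k).2); rewrite leeD2l.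
Qed.

(** The part of [A] in a big box has finite measure, so by Caratheodory's criterion its hull exceeds
    it by a null set only; a second hull makes that null set Borel. Countable unions then give the
    result for all of [A]. *)
Lemma measurable_ae_borel (A : set rVL) : measurable A ->
  exists A' N : set 'rV[R]_n, [/\ <<s boxes >> A', <<s boxes >> N, mu N = 0%E,
    A `<=` A' & A' `\` A `<=` N].
Proof.
move=> mA.
have /choice[G] : forall k, exists G : set 'rV[R]_n * set 'rV[R]_n,
   [/\ <<s boxes >> G.1, <<s boxes >> G.2, mu G.2 = 0%E,
    A `&` big_box k `<=` G.1 & G.1 `\` (A `&` big_box k) `<=` G.2].
  move=> k; set B := A `&` big_box k.
  have mB : measurable (B : set rVL).
    by apply: measurableI => //; exact: measurable_box.
  have Bfin : mu B \is a fin_num.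
    rewrite ge0_fin_numE ?lebesgue_outer_ge0//.
    exact: le_lt_trans (le_lebesgue_outer (@subIsetr _ _ _))
                       (lebesgue_outer_box_lty _ _).
  have [G mG [BG GB]] := lebesgue_outer_hull B.
  have [N mN [GN NG]] := lebesgue_outer_hull (G `\` B).
  exists (G, N); split => //=; rewrite NG; apply/eqP.
  have : mu G = (mu (G `&` B) + mu (G `&` ~` B))%E by exact: mB.
  rewrite setIidr// -setDE GB => /(congr1 (fun x => x - mu B)%E).
  by rewrite subee// addeAC subee// add0e => <-.
move=> GP; exists (\bigcup_k (G k).1), (\bigcup_k (G k).2); split.
- by apply: sigma_boxes_bigcup => k; have [] := GP k.
- by apply: sigma_boxes_bigcup => k; have [] := GP k.
- apply/eqP; rewrite eq_le lebesgue_outer_ge0 andbT.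
  apply: (le_trans (lebesgue_outer_bigcup _ _)).
  by rewrite esum1// => k _; have [] := GP k.
- move=> x Ax; have : [set: 'rV[R]_n] x by [].
  rewrite -bigcup_big_box => -[k _ xk]; exists k => //.
  by have [_ _ _ + _] := GP k; apply.
- move=> x [[k _ Gx] nAx]; exists k => //.
  by have [_ _ _ _] := GP k; apply; split => // -[].
Qed.

(* [F0] is [F] set to [0] on a null Borel set [N] that contains the defects of
   Borel hulls of all the sets [F > q] with [q] rational. *)
Lemma measurable_fun_ae_borel (F : rVL -> R) : measurable_fun setT F ->
  exists2 F0 : 'rV[R]_n -> R,
    measurable_fun setT (F0 : g_sigma_algebraType boxes -> R) &
    exists N, [/\ <<s boxes >> N, mu N = 0%E & forall x, ~ N x -> F x = F0 x].
Proof.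
move=> mF.
have /choice[G] : forall q : rat, exists G : set 'rV[R]_n * set 'rV[R]_n,
   [/\ <<s boxes >> G.1, <<s boxes >> G.2, mu G.2 = 0%E,
    F @^-1` `]ratr q, +oo[ `<=` G.1 & G.1 `\` (F @^-1` `]ratr q, +oo[) `<=` G.2].
  move=> q; have [|A [N]] := @measurable_ae_borel (F @^-1` `]ratr q, +oo[).
    by rewrite -[X in measurable X]setTI; exact: mF.
  by exists (A, N).
move=> GP; pose e k : rat := odflt 0 (unpickle k).
have eK q : e (pickle q) = q by rewrite /e pickleK.
pose N := \bigcup_k (G (e k)).2.
have mN : <<s boxes >> N.
  by apply: sigma_boxes_bigcup => k; have [] := GP (e k).
exists (fun x => if x \in N then 0 else F x); last first.
  exists N; split => // [|x nNx]; last by rewrite memNset.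
  apply/eqP; rewrite eq_le lebesgue_outer_ge0 andbT.
  apply: (le_trans (lebesgue_outer_bigcup _ _)).
  by rewrite esum1// => k _; have [] := GP (e k).
apply: (measurability _ (RGenOInfty.measurableE R)) => _ [_ [c ->] <-].
(* On [N] the new function is [0], which exceeds a rational exactly when that rational is negative;
   so [N] is added for negative [e k] and removed otherwise. *)
pose V k : set (g_sigma_algebraType boxes) := if c < ratr (e k) then
  (if 0 <= e k then (G (e k)).1 `\` N else (G (e k)).1 `|` N) else set0.
rewrite setTI (_ : _ @^-1` _ = \bigcup_k V k).
  apply: bigcupT_measurable => k; rewrite /V; case: ifP => // _.
  have [? _ _ _ _] := GP (e k).
  by case: ifP => _; [exact: measurableD|exact: measurableU].
have GF k x : (G (e k)).1 x -> ~ N x -> ratr (e k) < F x.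
  move=> Gx nNx; have [_ _ _ _ /(_ x) GN] := GP (e k).
  apply: contrapT => Fx; apply: nNx; exists k => //; apply: GN; split => //=.
  by rewrite in_itv/= andbT.
apply/seteqP; split => [x|x [k _]].
  rewrite /= in_itv/= andbT => /rat_in_itvoo[q].
  rewrite in_itv/= => /andP[cq qf]; exists (pickle q) => //.
  rewrite /V eK cq; have [_ _ _ FG _] := GP q.
  have GN : ~ N x -> (G q).1 x.
    by move=> nNx; apply: FG; rewrite /= in_itv/= andbT; move: qf; rewrite memNset.
  have [Nx|nNx] := pselect (N x); last by case: ifP => _; [split|left] => //; exact: GN.
  move: qf; rewrite mem_set// -(rmorph0 (@ratr R)) ltr_rat ltNge => /negbTE ->.
  by right.
rewrite /V; case: ifPn => // cq; rewrite /= in_itv/= andbT.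
have [Nx|nNx] := pselect (N x).
  rewrite mem_set//; case: ifPn => [_ []//|]; rewrite -ltNge -(ltr_rat R) rmorph0.
  by move=> q0 _; exact: lt_trans q0.
by rewrite memNset//; case: ifPn => _ => [[+ _]|[|//]] => /GF/(_ nNx); exact: lt_trans.
Qed.

End borel_hull.

(** * The maps [X |-> X + b v(X)] *)

Section comparison.
Context d1 d2 (X : measurableType d1) (Y : measurableType d2) (R : realType).
Variables (mu : {measure set X -> \bar R}) (nu : {measure set Y -> \bar R}).
Variables (phi : X -> Y) (C : R).
Hypothesis mphi : measurable_fun setT phi.
Hypothesis C_ge0 : 0 <= C.
Hypothesis mu_le : forall A, measurable A -> (mu (phi @^-1` A) <= C%:E * nu A)%E.

(** The pushforward of [mu] under [phi] is dominated by [C] times [nu] on sets, hence on nonnegative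
    functions. *)
Lemma ge0_integral_comp_le (g : Y -> \bar R) : measurable_fun setT g ->
  (forall y, 0 <= g y)%E ->
  (\int[mu]_x g (phi x) <= C%:E * \int[nu]_y g y)%E.
Proof.
move=> mg g0.
have <- : (\int[pushforward mu phi]_y g y = \int[mu]_x g (phi x))%E.
  by rewrite ge0_integral_pushforward.
rewrite -(@ge0_integral_mscale _ _ _ nu setT measurableT (NngNum C_ge0))//.
by apply: (ge0_le_measure_integral (m1 := pushforward mu phi)).
Qed.

End comparison.

Section flow.
Context {R : realType} {n : nat}.
Local Notation mu := (@lebesgue_outer R n).
Local Notation rVL := (lebesgue_rV R n).
Local Notation rVB := (g_sigma_algebraType (@boxes R n)).
Variables (K : R) (v : 'rV[R]_n -> 'rV[R]_n).
Hypothesis K_gt0 : 0 < K.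
Hypothesis lipv : unit_lipschitz_field K v.

Definition flow (b : R) (X : 'rV[R]_n) : 'rV[R]_n := X + b *: v X.

Lemma coord_unit_field_le1 X i : `|v X 0 i| <= 1.
Proof. by rewrite -(lipv.1 X) coord_le_l2norm. Qed.

(** [X - Y] differs from [flow b X - flow b Y] by [b (v X - v Y)], whose norm is at most [t K] times
    that of [X - Y] and can be absorbed on the left. *)
Lemma flow_inverse_lipschitz (t b : R) : t * K < 1 -> `|b| <= t ->
  forall X Y, l2norm (X - Y) <= (1 - t * K)^-1 * l2norm (flow b X - flow b Y).
Proof.
move=> tK bt X Y; rewrite mulrC ler_pdivlMr ?subr_gt0//.
have XY : X - Y = (flow b X - flow b Y) + (- b) *: (v X - v Y).
  by rewrite scaleNr scalerBr /flow; apply/rowP => i; rewrite !mxE; ring.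
have : l2norm (X - Y) <= l2norm (flow b X - flow b Y) + t * K * l2norm (X - Y).
  rewrite [leLHS](_ : _ =
    l2norm ((flow b X - flow b Y) + (- b) *: (v X - v Y))); last by rewrite -XY.
  apply: (le_trans (l2norm_triangle _ _)); rewrite lerD2l l2normZ normrN -mulrA.
  by apply: ler_pM => //; [exact: l2norm_ge0|exact: lipv.2].
by move: (l2norm _) (l2norm _) => a c; lra.
Qed.

Definition flow_const (t : R) : R := @distortion R n (1 - t * K)^-1 ^+ n.

Lemma flow_const_ge0 t : t * K < 1 -> 0 <= flow_const t.
Proof.
by move=> tK; rewrite exprn_ge0// ltW// distortion_gt0// invr_gt0 subr_gt0.
Qed.

Lemma lebesgue_outer_flow (t b : R) (A : set 'rV[R]_n) :
  t * K < 1 -> `|b| <= t ->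
  (mu (flow b @^-1` A) <= (flow_const t)%:E * mu A)%E.
Proof.
move=> tK bt; apply: lebesgue_outer_preimage; last exact: flow_inverse_lipschitz.
by rewrite invr_gt0 subr_gt0.
Qed.

Lemma measurable_field i : measurable_fun setT (fun X : rVL => v X 0 i).
Proof.
have n0 : (0 < n)%N by case: (n) i => // -[].
apply: (@measurable_fun_sup_lipschitz R n (fun X => v X 0 i) (K * n%:R)).
  by rewrite mulr_gt0// ltr0n.
move=> X Y d XYd.
have := coord_le_l2norm (v X - v Y) i; rewrite !mxE => /le_trans; apply.
apply: (le_trans (lipv.2 X Y)); rewrite -mulrA ler_pM2l//.
by apply: l2norm_le_coord => j; rewrite !mxE.
Qed.

Lemma measurable_fun_rVB d (S : measurableType d) (f : S -> rVB) :
  (forall i, measurable_fun setT (fun s => f s 0 i : R)) ->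
  measurable_fun setT f.
Proof.
move=> mf; apply: (@measurability _ _ S rVB setT f (@boxes R n) erefl).
move=> _ [_ [a [b ->]] <-].
rewrite setTI box_preimage.
rewrite (_ : _ @^-1` _ = \bigcap_(i in [set: 'I_n])
    (fun s => f s 0 i) @^-1` `]a 0 i, b 0 i]); last first.
  by apply/seteqP; split.
apply: fin_bigcap_measurable => // i _.
by rewrite -[X in measurable X]setTI; exact: mf.
Qed.

(** The target carries Borel sets only: the coordinates control preimages of boxes, while the
    preimage of a Lebesgue null set need not lie in the product sigma-algebra. *)
Lemma measurable_flow_joint d (S : measurableType d) (h : S -> R) :
  measurable_fun setT h ->
  measurable_fun setT (fun z : rVL * S => flow (h z.2) z.1 : rVB).
Proof.
move=> mh; apply: measurable_fun_rVB => i.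
rewrite (_ : (fun _ => _) = fun z : rVL * S => z.1 0 i + h z.2 * v z.1 0 i).
  apply: measurable_funD.
    by apply: (measurableT_comp (measurable_coord i)); exact: measurable_fst.
  apply: measurable_funM.
    by apply: (measurableT_comp mh); exact: measurable_snd.
  by apply: (measurableT_comp (measurable_field i)); exact: measurable_fst.
by apply/funext => z; rewrite !mxE.
Qed.

Lemma measurable_flow_borel b : measurable_fun setT (flow b : rVL -> rVB).
Proof.
apply: measurable_fun_rVB => i.
rewrite (_ : (fun _ => _) = fun X : rVL => X 0 i + b * v X 0 i).
  apply: measurable_funD; first exact: measurable_coord.
  by apply: measurable_funM => //; exact: measurable_field.
by apply/funext => z; rewrite !mxE.
Qed.

Lemma lebesgue_outer0_measurable (A : set rVL) : mu A = 0%E -> measurable A.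
Proof.
move=> A0; have [G mG [AG GA]] := lebesgue_outer_hull A.
apply: measure_is_complete_caratheodory; exists G; split => //.
  exact: sub_boxes_measurable.
by rewrite -A0 -GA.
Qed.

(** [A] is a Borel set minus a part of a null set; the preimage of that part is null by
    [lebesgue_outer_flow], hence measurable by completeness. *)
Lemma measurable_flow (t b : R) : t * K < 1 -> `|b| <= t ->
  measurable_fun setT (flow b : rVL -> rVL).
Proof.
move=> tK bt _ A mA; rewrite setTI.
have [A' [N [mA' mN N0 AA' A'N]]] := measurable_ae_borel mA.
rewrite (_ : _ @^-1` _ = flow b @^-1` A' `\` flow b @^-1` (A' `\` A)).
  apply: measurableD.
    by rewrite -[X in measurable X]setTI; apply: measurable_flow_borel.
  apply: lebesgue_outer0_measurable; apply/eqP.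
  rewrite eq_le lebesgue_outer_ge0 andbT.
  apply: (le_trans (lebesgue_outer_flow _ tK bt)).
  apply: (@le_trans _ _ ((flow_const t)%:E * mu N)%E).
    by rewrite lee_wpmul2l ?lee_fin ?flow_const_ge0// le_lebesgue_outer.
  by rewrite N0 mule0.
apply/seteqP; split => X /= => [AX|[A'X nAX]]; first by split; [exact: AA'|case].
by apply: contrapT => nA; apply: nAX.
Qed.

Lemma ge0_integral_flow_le (t b : R) (g : rVL -> \bar R) :
  t * K < 1 -> `|b| <= t -> measurable_fun setT g -> (forall x, 0 <= g x)%E ->
  (\int[lebesgue_measure_rV n]_x g (flow b x) <=
   (flow_const t)%:E * \int[lebesgue_measure_rV n]_x g x)%E.
Proof.
move=> tK bt mg g0; apply: ge0_integral_comp_le => //.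
- exact: measurable_flow tK bt.
- exact: flow_const_ge0.
- by move=> A _; exact: lebesgue_outer_flow.
Qed.

End flow.

(** * Points that enter or leave a set under a small displacement *)

Section flow_defect.
Context {R : realType} {n : nat}.
Local Notation mu := (@lebesgue_outer R n).
Local Notation rVL := (lebesgue_rV R n).
Variables (K : R) (v : 'rV[R]_n -> 'rV[R]_n).
Hypothesis K_gt0 : 0 < K.
Hypothesis lipv : unit_lipschitz_field K v.
Local Notation phi := (flow v).

Definition flow_defect (b : R) (A : set 'rV[R]_n) : set 'rV[R]_n :=
  (A `\` phi b @^-1` A) `|` (phi b @^-1` A `\` A).

(* A point that enters or leaves a box lies in a slab of thickness about [b]
   around one of its faces. *)
Lemma flow_defect_box (l u : 'rV[R]_n) : exists2 M : R, 0 <= M &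
  forall b, `|b| <= 1 -> (mu (flow_defect b (box l u)) <= (M * `|b|)%:E)%E.
Proof.
(* With [s = |b| <= 1], a slab reaches from [- 2 s] to [s] around its face, hence the thickness
   [3 s]; each other side is that of the box enlarged by [3 s <= 3]. *)
pose W i := 3 * \prod_(j < n | j != i) (`|u 0 j - l 0 j| + 3).
have W0 i : 0 <= W i by rewrite mulr_ge0// prodr_ge0// => j _; rewrite addr_ge0.
exists (\sum_(ie : 'I_n * bool) W ie.1); first by rewrite sumr_ge0.
move=> b b1; have [->|b0] := eqVneq b 0.
  rewrite normr0 mulr0 (_ : flow_defect _ _ = set0) ?lebesgue_outer0//.
  have flow0 X : phi 0 X = X by rewrite /flow scale0r addr0.
  by rewrite -subset0 => X [] []; rewrite /= flow0.
set s := `|b| in b1 *; have s0 : 0 < s by rewrite normr_gt0.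
pose face (ie : 'I_n * bool) : R := if ie.2 then l 0 ie.1 else u 0 ie.1.
pose slab_l (ie : 'I_n * bool) : 'rV[R]_n :=
  \row_j ((if j == ie.1 then face ie else l 0 j) - 2 * s).
pose slab_u (ie : 'I_n * bool) : 'rV[R]_n :=
  \row_j ((if j == ie.1 then face ie else u 0 j) + s).
have step (X : 'rV[R]_n) i : X 0 i - s <= phi b X 0 i <= X 0 i + s.
  rewrite -ler_distl /flow !mxE addrAC subrr add0r normrM.
  by rewrite ler_piMr// (coord_unit_field_le1 lipv).
have cover X : flow_defect b (box l u) X ->
    exists2 ie, true & box (slab_l ie) (slab_u ie) X.
  move=> XD.
  have near j : l 0 j - 2 * s < X 0 j <= u 0 j + s.
    have := step X j; case: XD => -[/(_ j)/andP[? ?] _] /andP[? ?]; lra.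
  have [i [e ie]] : exists i e, face (i, e) - 2 * s < X 0 i <= face (i, e) + s.
    case: XD => -[inX /existsNP[i]]; have := step X i; have := inX i => /=.
      move=> /andP[? ?] /andP[? ?] /negP; rewrite negb_and -leNgt -ltNge => /orP[?|?].
      - by exists i, true => /=; rewrite /face/=; lra.
      - by exists i, false => /=; rewrite /face/=; lra.
    move=> /andP[? ?] /andP[? ?] /negP; rewrite negb_and -leNgt -ltNge => /orP[?|?].
    - by exists i, true => /=; rewrite /face/=; lra.
    - by exists i, false => /=; rewrite /face/=; lra.
  exists (i, e) => // j; rewrite !mxE/=; case: eqP => [->|_]; first exact: ie.
  exact: near.
apply: (le_trans (lebesgue_outer_cover cover)).
rewrite mulr_suml -sumEFin; apply: lee_sum => ie _.
apply: (le_trans (lebesgue_outer_box_le _ _)); rewrite lee_fin.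
rewrite /box_vol (bigD1 ie.1)//= !mxE eqxx /W mulrAC; apply: ler_pM.
- by rewrite le_max lexx.
- by rewrite prodr_ge0// => j _; rewrite le_max lexx.
- by rewrite ge_max; lra.
apply: ler_prod => j /negbTE ji; rewrite !mxE ji le_max lexx/= ge_max.
by apply/andP; split; [rewrite addr_ge0|have := ler_norm (u 0 j - l 0 j); lra].
Qed.

(* [A] is compared with the union [S] of finitely many boxes of an almost
   optimal cover; the flow distorts the measure of [A `\` S] and [S `\` A] by a
   bounded factor only. *)
Lemma flow_defect_cvg (A : set rVL) : measurable A -> (mu A < +oo)%E ->
  forall e : R, 0 < e -> exists2 d : R, 0 < d &
  forall b, `|b| <= d -> (mu (flow_defect b A) <= e%:E)%E.
Proof.
move=> mA Aoo e e0.
have Afin : mu A \is a fin_num by rewrite ge0_fin_numE ?lebesgue_outer_ge0.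
pose t0 := (2 * K)^-1.
have t00 : 0 < t0 by rewrite invr_gt0 mulr_gt0.
have t0K : t0 * K < 1 by rewrite /t0 invfM mulfVK ?gt_eqF//; lra.
set C := @flow_const R n K t0; have C0 : 0 <= C by exact: flow_const_ge0.
(* The two differences of [A] and [S] and their preimages cost [2 h + 2 C h = e / 2]; the other half
   is left for the boxes that make up [S]. *)
pose h := e / (4 * (1 + C)).
have h0 : 0 < h by rewrite divr_gt0// mulr_gt0// ltr_wpDr.
have [_ [[D g] Dg <-] /ltW/= cA] := lb_ereal_inf_adherent h0 Afin.
pose B k := box (g k).1 (g k).2.
pose vol k := (if k \in D then (box_vol (g k).1 (g k).2)%:E else 0)%E.
have vol0 k : (0 <= vol k)%E.
  by rewrite /vol; case: ifP => // _; rewrite lee_fin box_vol_ge0.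
have volE : cover_vol (D, g) = (\sum_(k <oo) vol k)%E.
  by rewrite /cover_vol/= esum_mkcond nneseries_esumT.
have voloo : (\sum_(k <oo) vol k < +oo)%E.
  by rewrite -volE (le_lt_trans cA)// lte_add_pinfty// ltry.
have [N tailN] : exists N, (\sum_(N <= k <oo) vol k <= h%:E)%E.
  have /fine_cvgP[tfin /cvgrPdist_le/(_ _ h0) th] :=
    nneseries_tail_cvg voloo (fun k _ => vol0 k).
  have [N [Nfin Nh]] := @filter_ex _ _ _ _ (filterI tfin th); exists N.
  rewrite -[leLHS]fineK// lee_fin; apply: le_trans Nh.
  by rewrite sub0r normrN ler_norm.
pose S := [set X | exists k, [/\ (k < N)%N, D k & B k X]].
have AS : (mu (A `\` S) <= h%:E)%E.
  apply: le_trans tailN.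
  apply: (@le_trans _ _ (mu (\bigcup_(k in ~` `I_N) if k \in D then B k else set0))).
    apply: le_lebesgue_outer => X [/Dg[k Dk BkX] nS]; exists k => //=.
      by move=> kN; apply: nS; exists k.
    by rewrite mem_set.
  apply: (le_trans (outer_measure_sigma_subadditive_tail _ _ _)).
  apply: lee_nneseries => k _; first by rewrite lebesgue_outer_ge0.
  rewrite /vol; case: ifP => _; last by rewrite outer_measure0.
  exact: lebesgue_outer_box_le.
have SA : (mu (S `\` A) <= h%:E)%E.
  (* [A] is measurable and contained in the union [U] of the whole cover, whose measure is at most
     that of [A] plus [h]. *)
  pose U := \bigcup_(k in D) B k.
  apply: (@le_trans _ _ (mu (U `&` ~` A))).
    by apply: le_lebesgue_outer => X [[k [_ Dk BkX]] nA]; split => //; exists k.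
  have : (mu U <= mu A + h%:E)%E.
    apply: le_trans cA; apply: (le_trans (lebesgue_outer_bigcup _ _)).
    by apply: le_esum => k _; exact: lebesgue_outer_box_le.
  have -> : mu U = (mu (U `&` A) + mu (U `&` ~` A))%E by exact: mA.
  by rewrite setIidr ?leeD2lE// => X /Dg.
have /choice[M MP] : forall k, exists M : R, 0 <= M /\
    forall b, `|b| <= 1 -> (mu (flow_defect b (B k)) <= (M * `|b|)%:E)%E.
  by move=> k; have [M ? ?] := flow_defect_box (g k).1 (g k).2; exists M.
pose Q := \sum_(k < N) M k.
have Q0 : 0 <= Q by rewrite sumr_ge0// => k _; exact: (MP k).1.
(* [Q + 1] keeps the denominator positive when [Q = 0]. *)
exists (Num.min (Num.min t0 1) (e / (2 * (Q + 1)))).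
  by rewrite !lt_min t00 ltr01/= divr_gt0// mulr_gt0// ltr_wpDl.
move=> b; rewrite !le_min -andbA => /and3P[bt b1 bQ].
have flow_small E : (mu E <= h%:E)%E -> (mu (phi b @^-1` E) <= (C * h)%:E)%E.
  move=> Eh; apply: (le_trans (lebesgue_outer_flow lipv _ t0K bt)).
  by rewrite EFinM lee_wpmul2l ?lee_fin.
have flowAS := flow_small _ AS; have flowSA := flow_small _ SA.
pose T := [set X | exists2 k : 'I_N, true & flow_defect b (B k) X].
have Te : (mu T <= (e / 2)%:E)%E.
  apply: (@le_trans _ _ (\sum_(k < N) mu (flow_defect b (B k)))%E).
    by apply: lebesgue_outer_cover => X.
  apply: (@le_trans _ _ (\sum_(k < N) (M k * `|b|)%:E)%E).
    by apply: lee_sum => k _; exact: (MP k).2.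
  rewrite sumEFin lee_fin -mulr_suml -/Q.
  apply: (@le_trans _ _ ((Q + 1) * `|b|)); first by rewrite ler_wpM2r// lerDl.
  move: bQ; rewrite invfM mulrA ler_pdivlMr ?ltr_wpDl//; first by rewrite mulrC.
have hE : h + h + (C * h + C * h) = e / 2.
  by rewrite /h; field; rewrite gt_eqF// ltr_wpDr.
have -> : e = h + h + (C * h + C * h) + e / 2 by rewrite hE; lra.
(* If no box of [S] separates [X] from [phi b X], then [S] contains both or neither; as [A] contains
   exactly one of them, one of the two points lies in exactly one of [A] and [S]. *)
apply: (@le_trans _ _ (mu (((A `\` S) `|` (S `\` A)) `|`
    (phi b @^-1` (A `\` S) `|` phi b @^-1` (S `\` A)) `|` T))).
  apply: le_lebesgue_outer => X AX.
  have [[k bX]|nT] := pselect (exists k : 'I_N, flow_defect b (B k) X).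
    by right; exists k.
  have nB k : (k < N)%N -> B k X <-> B k (phi b X).
    move=> kN; split => BX; apply: contrapT => nBX; apply: nT;
      exists (Ordinal kN); [left|right] => //.
  left; have [SX|nSX] := pselect (S X).
    have SfX : S (phi b X) by case: SX => k [kN ? ?]; exists k; split => //; apply/nB.
    case: AX => [[AX nAX]|[AX nAX]]; first by right; right; split.
    by left; right; split.
  have nSfX : ~ S (phi b X).
    by move=> [k [kN ? ?]]; apply: nSX; exists k; split => //; apply/nB.
  case: AX => [[AX nAX]|[AX nAX]]; first by left; left; split.
  by right; left; split.
rewrite !EFinD.
do 4![apply: (le_trans (outer_measureU2 _ _ _)); apply: leeD => //].
Qed.

End flow_defect.

(** * Continuity in L^p *)

Section powR_inequalities.
Context {R : realType}.
Implicit Types x y a b p : R.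

(** Write each power as [x * x ^ (p - 1)] and bound the second factor by that of [a + b]. *)
Lemma powR_superadditive a b p : 0 <= a -> 0 <= b -> 1 <= p ->
  a `^ p + b `^ p <= (a + b) `^ p.
Proof.
move=> a0 b0 p1; have p0 : 0 < p by rewrite (lt_le_trans _ p1).
have q0 : 0 <= p - 1 by rewrite subr_ge0.
rewrite -(mulr_powRB1 a0 p0) -(mulr_powRB1 b0 p0).
rewrite -(mulr_powRB1 (addr_ge0 a0 b0) p0) mulrDl.
by apply: lerD; apply: ler_wpM2l => //; apply: ge0_ler_powR => //;
  rewrite ?nnegrE ?addr_ge0// ?lerDl ?lerDr.
Qed.

(** Superadditivity for [a - b] and [b]. It bounds an L^p distance of nonnegative functions by an
    L^1 distance of their [p]-th powers. *)
Lemma powR_distr_le a b p : 0 <= a -> 0 <= b -> 1 <= p ->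
  `|a - b| `^ p <= `|a `^ p - b `^ p|.
Proof.
wlog ba : a b / b <= a => [wl|] a0 b0 p1.
  have [ba|/ltW ab] := leP b a; first exact: wl.
  by rewrite distrC [leRHS]distrC wl.
rewrite ger0_norm ?subr_ge0//; apply: le_trans (ler_norm _).
by rewrite lerBrDr -[in leRHS](subrK b a) powR_superadditive ?subr_ge0.
Qed.

(** The distance of [x] and [y] is at most the sum of the distances of their positive and of their
    negative parts, thus at most twice the larger of the two. *)
Lemma powR_distr_pos_neg_le x y p : 1 <= p ->
  `|x - y| `^ p <= 2 `^ p *
    (`|Num.max x 0 `^ p - Num.max y 0 `^ p| +
     `|Num.max (- x) 0 `^ p - Num.max (- y) 0 `^ p|).
Proof.
move=> p1; have p0 : 0 <= p by rewrite (le_trans _ p1).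
set a := `|Num.max x 0 - Num.max y 0|.
set b := `|Num.max (- x) 0 - Num.max (- y) 0|.
have max0 (z : R) : 0 <= Num.max z 0 by rewrite le_max lexx orbT.
have ab0 : 0 <= Num.max a b by rewrite le_max normr_ge0.
apply: (@le_trans _ _ (2 `^ p * (a `^ p + b `^ p))); last first.
  by rewrite ler_wpM2l ?powR_ge0// lerD// powR_distr_le.
apply: (@le_trans _ _ ((2 * Num.max a b) `^ p)).
  apply: ge0_ler_powR; rewrite ?nnegrE ?mulr_ge0//.
  apply: (@le_trans _ _ (a + b)).
    have posneg (z : R) : z = Num.max z 0 - Num.max (- z) 0.
      by rewrite /Num.max; case: ltP => ?; case: ltP => ?; lra.
    rewrite [x in `|x - _|]posneg [y in `|_ - y|]posneg.
    rewrite [X in `|X|](_ : _ = (Num.max x 0 - Num.max y 0) -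
      (Num.max (- x) 0 - Num.max (- y) 0)); last by ring.
    exact: ler_normB.
  by case: (leP a b) => ?; lra.
rewrite powRM// ler_wpM2l ?powR_ge0//.
by case: (leP a b) => _; rewrite ?lerDl ?lerDr powR_ge0.
Qed.

End powR_inequalities.

Lemma finite_pos_lower_bound (R : realType) (N : nat) (d : nat -> R) :
  (forall k, (k < N)%N -> 0 < d k) ->
  exists2 d0, 0 < d0 & forall k, (k < N)%N -> d0 <= d k.
Proof.
elim: N => [_|N IH dN]; first by exists 1.
have [k kN|d0 d00 d0N] := IH; first by rewrite dN// ltnS ltnW.
exists (Num.min d0 (d N)); first by rewrite lt_min d00 dN.
move=> k; rewrite ltnS leq_eqVlt => /orP[/eqP ->|kN].
  by rewrite ge_min lexx orbT.
by rewrite ge_min d0N.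
Qed.

Section Lp_continuity.
Context disp (T : measurableType disp) (R : realType).
Variable mu : {measure set T -> \bar R}.
Variables (phi : R -> T -> T) (t0 C : R).
Hypothesis t0_gt0 : 0 < t0.
Hypothesis C_ge0 : 0 <= C.
Hypothesis mphi_ : forall b, `|b| <= t0 -> measurable_fun setT (phi b).
Hypothesis mu_phi_le : forall b, `|b| <= t0 -> forall A, measurable A ->
  (mu (phi b @^-1` A) <= C%:E * mu A)%E.
Let defect b A := (A `\` phi b @^-1` A) `|` (phi b @^-1` A `\` A).
Hypothesis defect_cvg : forall A, measurable A -> (mu A < +oo)%E ->
  forall e : R, 0 < e -> exists2 d : R, 0 < d &
  forall b, `|b| <= d -> (mu (defect b A) <= e%:E)%E.

Import HBSimple.

(** Where [h] changes along [phi b], one of its two values is nonzero, so the point lies in the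
    defect of the level set of that value. Level sets of nonzero values have finite measure by
    integrability; that of [0] may not, and is left out. *)
Lemma comp_sfun_cvg (h : {sfun T >-> R}) : mu.-integrable setT (EFin \o h) ->
  forall e : R, 0 < e -> exists2 d : R, 0 < d & forall b, `|b| <= d ->
  (\int[mu]_x `|(h (phi b x))%:E - (h x)%:E| <= e%:E)%E.
Proof.
move=> inth e e0.
have /finite_seqP[s sE] : finite_set (range h) by exact: fimfunP.
have [M M0 hM] : exists2 M : R, 0 < M & forall x, `|h x| <= M.
  have [M [_ hM]] := simple_bounded h; exists (`|M| + 1).
    by rewrite ltr_wpDl.
  move=> x; apply: (hM (`|M| + 1)) => //.
  by rewrite (le_lt_trans (ler_norm M))// ltrDl.
have mh : measurable_fun setT (h : T -> R) by [].
pose A i : set T := h @^-1` [set nth 0 s i].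
have mA i : measurable (A i) by exact: measurable_funPTI.
have Aoo i : nth 0 s i != 0 -> (mu (A i) < +oo)%E.
  move=> si; have yA : (`|nth 0 s i|%:E * mu (A i) <= \int[mu]_x `|(h x)%:E|)%E.
    rewrite -[A i]setIT -integral_indic// -ge0_integralZl_EFin//; last exact/measurable_EFinP.
    apply: ge0_le_integral => //.
    - by apply: measurable_funeM; exact/measurable_EFinP.
    - exact/measurableT_comp/measurable_EFinP.
    - move=> x _; rewrite -EFinM /= lee_fin indicE.
      by have [/set_mem <-|_] := boolP (x \in A i); rewrite ?mulr1 ?mulr0.
  have /integrableP[_ hoo] := inth.
  rewrite ltey; apply/eqP => Ay; move: yA; rewrite Ay gt0_muley ?lte_fin ?normr_gt0//.
  by rewrite leNgt hoo.
(* A change of [h] is at most [2 M], and [s] lists at most [size s] level sets; the successor keeps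
   the denominator positive. *)
pose e' := e / (2 * M * (size s).+1%:R).
have e'0 : 0 < e' by rewrite divr_gt0// !mulr_gt0.
have /choice[d dP] : forall i, exists d : R, 0 < d /\
    (nth 0 s i != 0 -> forall b, `|b| <= d ->
      (mu (defect b (A i)) <= e'%:E)%E).
  move=> i; have [_|s0] := eqVneq (nth 0 s i) 0.
    by exists 1.
  by have [d d0 dA] := defect_cvg (mA i) (Aoo i s0) e'0; exists d.
have [d0 d00 dd0] := @finite_pos_lower_bound R (size s) d (fun k _ => (dP k).1).
exists (Num.min d0 t0); first by rewrite lt_min d00.
move=> b; rewrite le_min => /andP[bd bt].
have mhphi : measurable_fun setT (h \o phi b : T -> R).
  apply: measurableT_comp => //.
  exact: mphi_.
pose E : set T := [set x | h (phi b x) != h x].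
have mE : measurable E.
  rewrite (_ : E = ((h \o phi b) \- h)%R @^-1` [set~ 0]).
    rewrite -[X in measurable X]setTI.
    by apply: measurable_funB => //; apply: measurableC.
  by apply/seteqP; split => x /=; rewrite /E/= -subr_eq0 => /eqP.
apply: (@le_trans _ _ (\int[mu]_x (2 * M * \1_E x)%:E)%E).
  apply: ge0_le_integral => //.
  - apply: measurableT_comp => //; apply/measurable_EFinP.
    exact: measurable_funB.
  - by apply/measurable_EFinP; apply: measurable_funM.
  - move=> x _; rewrite -EFinB /= lee_fin indicE.
    have [->|hx] := eqVneq (h (phi b x)) (h x).
      by rewrite subrr normr0 !mulr_ge0// ltW.
    rewrite mem_set//= mulr1 (le_trans (ler_normB _ _))// mulr_natl mulr2n.
    by rewrite lerD.
under eq_integral do rewrite EFinM.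
rewrite ge0_integralZl_EFin//; last 2 first.
- exact/measurable_EFinP.
- by rewrite mulr_ge0// ltW.
rewrite integral_indic// setIT.
pose D i := if nth 0 s i != 0 then defect b (A i) else set0.
have mphiA i : measurable (phi b @^-1` A i).
  by rewrite -[X in measurable X]setTI; apply: mphi_.
have mD i : measurable (D i).
  by rewrite /D; case: ifP => // _; apply: measurableU; exact: measurableD.
have ED : E `<=` \big[setU/set0]_(i < size s) D i.
  move=> x Ex.
  have inD (i : 'I_(size s)) : D i x -> (\big[setU/set0]_(i < size s) D i) x.
    by move=> Dix; rewrite (bigD1 i)//=; left.
  have idx z : h z != 0 -> exists2 i : 'I_(size s), nth 0 s i != 0 & A i z.
    move=> hz; have : range h (h z) by exists z.
    rewrite sE /= => /(nthP 0)[i si hi]; exists (Ordinal si) => //=.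
    by rewrite hi.
  have [hx|/idx[i si Ax]] := eqVneq (h x) 0; last first.
    apply: (inD i); rewrite /D si; left; split => // Apx.
    by move: Ex; rewrite /E /= Apx Ax eqxx.
  have : h (phi b x) != 0 by rewrite -hx.
  move=> /idx[i si Apx]; apply: (inD i); rewrite /D si; right; split => // Ax.
  by move: si; rewrite -Ax hx eqxx.
have E_defect : (mu E <= \sum_(i < size s) e'%:E)%E.
  apply: (@le_trans _ _ (mu (\big[setU/set0]_(i < size s) D i))).
    by apply: le_measure => //; rewrite inE//; exact: bigsetU_measurable.
  apply: (le_trans (Boole_inequality mu (fun i _ => mD i))); apply: lee_sum => i _.
  rewrite /D; case: ifPn => [si|_]; last by rewrite measure0 lee_fin ltW.
  by apply: (dP i).2 => //; rewrite (le_trans bd)// dd0.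
have M20 : (0 <= (2 * M)%:E)%E by rewrite lee_fin mulr_ge0// ltW.
apply: (le_trans (lee_wpmul2l M20 E_defect)).
rewrite sumEFin -EFinM lee_fin.
apply: (@le_trans _ _ (2 * M * ((size s)%:R * e'))).
  apply: ler_wpM2l; first by rewrite mulr_ge0// ltW.
  by rewrite sumr_const card_ord -[leLHS]mulr_natl.
have -> : e = 2 * M * ((size s).+1%:R * e').
  by rewrite /e' mulrA mulrC divfK// gt_eqF// !mulr_gt0.
apply: ler_wpM2l; first by rewrite mulr_ge0// ltW.
by apply: ler_wpM2r; rewrite ?ler_nat// ltW.
Qed.

Lemma comp_L1_cvg (g : T -> R) : mu.-integrable setT (EFin \o g) ->
  forall e : R, 0 < e -> exists2 d : R, 0 < d & forall b, `|b| <= d ->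
  (\int[mu]_x `|g (phi b x) - g x|%:E <= e%:E)%E.
Proof.
move=> intg e e0.
have /integrableP[/measurable_EFinP mg _] := intg.
(* Replacing [g] by [h] costs [C q] after composition with [phi b] and [q] before it, [e / 2] in
   total; [h] itself gets the other half. *)
pose q := e / (2 * (C + 1)).
have q0 : 0 < q by rewrite divr_gt0// mulr_gt0// ltr_wpDl.
have [h [inth gh]] : exists h : {sfun T >-> R},
    mu.-integrable setT (EFin \o h) /\
    (\int[mu]_x `|(g x)%:E - (h x)%:E| <= q%:E)%E.
  have [h_ [inth _ /fine_cvgP[hfin /cvgrPdist_le/(_ _ q0) hq]]] :=
    approximation_sfun_integrable measurableT intg.
  have [k [kfin kq]] := @filter_ex _ _ _ _ (filterI hfin hq).
  exists (h_ k); split => //.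
  rewrite -[leLHS]fineK// lee_fin; apply: le_trans kq.
  by rewrite sub0r normrN ler_norm.
have e20 : 0 < e / 2 by rewrite divr_gt0.
have [d d0 hd] := comp_sfun_cvg inth e20.
exists (Num.min d t0); first by rewrite lt_min d0 t0_gt0.
move=> b; rewrite le_min => /andP[bd bt].
have mphi := mphi_ bt.
have mh : measurable_fun setT (h : T -> R) by [].
have mghn : measurable_fun setT (fun x : T => `|(g x)%:E - (h x)%:E|%E).
  by apply: measurableT_comp => //; apply/measurable_EFinP; exact: measurable_funB.
have mhh : measurable_fun setT (fun x : T => `|(h (phi b x))%:E - (h x)%:E|%E).
  apply: measurableT_comp => //; apply/measurable_EFinP; apply: measurable_funB => //.
  exact: (measurableT_comp mh mphi).
have mgh_phi : measurable_fun setT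
    (fun x : T => `|(g (phi b x))%:E - (h (phi b x))%:E|%E).
  exact: (measurableT_comp mghn mphi).
apply: (@le_trans _ _ (\int[mu]_x (`|(g (phi b x))%:E - (h (phi b x))%:E| +
   (`|(h (phi b x))%:E - (h x)%:E| + `|(g x)%:E - (h x)%:E|)))%E).
  apply: ge0_le_integral => //.
  - apply/measurable_EFinP; apply: measurableT_comp => //; apply: measurable_funB => //.
    exact: (measurableT_comp mg mphi).
  - by apply: emeasurable_funD => //; exact: emeasurable_funD.
  - move=> x _; rewrite -!EFinB /= -!EFinD lee_fin [`|g x - _|]distrC.
    apply: (le_trans (ler_distD (h (phi b x)) _ _)); rewrite lerD2l.
    exact: ler_distD.
rewrite ge0_integralD//; last 2 first.
- by move=> x _; rewrite adde_ge0.
- exact: emeasurable_funD.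
rewrite ge0_integralD//.
have gh_phi := ge0_integral_comp_le mphi C_ge0 (mu_phi_le bt) mghn (fun x => abse_ge0 _).
apply: (@le_trans _ _ ((C * q)%:E + ((e / 2)%:E + q%:E))%E).
  apply: leeD; last by apply: leeD => //; exact: hd.
  by apply: (le_trans gh_phi); rewrite EFinM lee_wpmul2l ?lee_fin.
rewrite -!EFinD lee_fin.
have : (C + 1) * q = e / 2 by rewrite /q; field; rewrite gt_eqF// ltr_wpDl.
by rewrite mulrDl mul1r; lra.
Qed.

(* [powR_distr_pos_neg_le] reduces to continuity in L^1 of the [p]-th powers of
   the positive and negative parts. *)
Lemma comp_Lp_cvg (p : R) (F : T -> R) : 1 <= p -> measurable_fun setT F ->
  (\int[mu]_x (`|F x| `^ p)%:E < +oo)%E ->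
  forall e : R, 0 < e -> exists2 d : R, 0 < d & forall b, `|b| <= d ->
  (\int[mu]_x (`|F (phi b x) - F x| `^ p)%:E <= e%:E)%E.
Proof.
move=> p1 mF Foo e e0; have p0 : 0 <= p by rewrite (le_trans _ p1).
have mpow (G : T -> R) : measurable_fun setT G ->
    measurable_fun setT (fun x => G x `^ p).
  by move=> mG; apply: (measurableT_comp (measurable_powR p)).
(* For [s = 1] and [s = -1] these are the [p]-th powers of the positive and negative parts of
   [F]. *)
pose part (s : R) (x : T) := Num.max (s * F x) 0 `^ p.
have mpart s : measurable_fun setT (part s).
  by apply: mpow; apply: measurable_maxr => //; exact: measurable_funM.
have intpart s : `|s| = 1 -> mu.-integrable setT (EFin \o part s).
  move=> s1; apply/integrableP; split; first exact/measurable_EFinP.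
  apply: le_lt_trans Foo; apply: ge0_le_integral => //.
  - exact/measurableT_comp/measurable_EFinP.
  - by apply/measurable_EFinP/mpow; exact: measurableT_comp.
  - move=> x _; rewrite /= lee_fin ger0_norm ?powR_ge0//.
    apply: ge0_ler_powR => //; rewrite ?nnegrE ?le_max ?lexx ?orbT//.
    by rewrite ge_max normr_ge0 andbT -[leRHS]mul1r -s1 -normrM ler_norm.
pose e' := e / 2 / (2 `^ p).
have c0 : 0 < 2 `^ p :> R by rewrite powR_gt0.
have e'0 : 0 < e' by rewrite !divr_gt0.
have [d1 d10 hd1] := comp_L1_cvg (intpart 1 (normr1 _)) e'0.
have [d2 d20 hd2] := comp_L1_cvg (intpart (-1) (normrN1 _)) e'0.
exists (Num.min t0 (Num.min d1 d2)); first by rewrite !lt_min t0_gt0 d10.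
move=> b; rewrite !le_min => /and3P[bt bd1 bd2].
have mphi := mphi_ bt.
have mdiff s : measurable_fun setT
    (fun x : T => (`|part s (phi b x) - part s x|)%:E).
  apply/measurable_EFinP; apply: measurableT_comp => //; apply: measurable_funB => //.
  exact: (measurableT_comp (mpart s) mphi).
apply: (@le_trans _ _ (\int[mu]_x ((2 `^ p)%:E *
   (`|part 1 (phi b x) - part 1 x|%:E + `|part (-1) (phi b x) - part (-1) x|%:E)))%E).
  apply: ge0_le_integral => //.
  - apply/measurable_EFinP/mpow; apply: measurableT_comp => //.
    by apply: measurable_funB => //; exact: (measurableT_comp mF mphi).
  - by apply: measurable_funeM; exact: emeasurable_funD.
  - move=> x _; rewrite -EFinD -EFinM lee_fin /part !mul1r !mulN1r.
    exact: powR_distr_pos_neg_le.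
rewrite ge0_integralZl_EFin ?powR_ge0//; last 2 first.
- by move=> x _; rewrite adde_ge0.
- exact: emeasurable_funD.
rewrite ge0_integralD//.
apply: (@le_trans _ _ ((2 `^ p)%:E * (e'%:E + e'%:E))%E).
  apply: lee_wpmul2l; first by rewrite lee_fin powR_ge0.
  by apply: leeD; [exact: hd1|exact: hd2].
rewrite -EFinD -EFinM lee_fin (_ : _ * _ = e)//.
by rewrite /e'; field; rewrite gt_eqF.
Qed.

End Lp_continuity.

(** * Averages over sections *)

Section jensen.
Context disp (S : measurableType disp) (R : realType).
Variable lam : {measure set S -> \bar R}.
Variables (D : set S) (r : R).
Hypothesis mD : measurable D.
Hypothesis r_gt0 : 0 < r.
Hypothesis lamD : lam D = r%:E.

(* The tangent of [x `^ p] at [m] lies below the graph, with both sides moved so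
   that all terms are nonnegative. *)
Lemma powR_tangent (x m p : R) : 0 <= x -> 0 <= m -> 1 <= p ->
  p * m `^ (p - 1) * x <= x `^ p + (p - 1) * m `^ p.
Proof.
move=> x0 m0; rewrite le_eqVlt => /predU1P[<-|p1].
  by rewrite subrr mul0r addr0 powRr0 !mul1r powRr1.
have p0 : 0 < p by rewrite (lt_trans _ p1).
have q0 : 0 < p - 1 by rewrite subr_gt0.
have pq : p^-1 + (p / (p - 1))^-1 = 1.
  by field; rewrite !gt_eqF.
(* Young's inequality for [x] and [m ^ (p - 1)] with exponents [p] and [p / (p - 1)]; multiplied by
   [p] it is the claim. *)
have := conjugate_powR x0 (powR_ge0 m (p - 1)) p0 (divr_gt0 p0 q0) pq.
rewrite -powRrM mulrCA divff ?gt_eqF// mulr1 invf_div.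
rewrite -(ler_pM2l p0) => young.
rewrite [leLHS](_ : _ = p * (x * m `^ (p - 1))); last by ring.
apply: (le_trans young); rewrite le_eqVlt; apply/orP; left; apply/eqP.
by field; rewrite gt_eqF.
Qed.

(** With [m] the mean of [|f - c|], integrating the tangent inequality at [m] gives
    [p m^p r <= J + (p - 1) m^p r]. Only the finite last term is subtracted, so [J] may be
    infinite. *)
Lemma jensen_mean (f : S -> R) (p c : R) : 1 <= p ->
  lam.-integrable D (EFin \o f) ->
  ((`|r^-1 * \int[lam]_(b in D) f b - c| `^ p)%:E <=
   (r^-1)%:E * \int[lam]_(b in D) (`|f b - c| `^ p)%:E)%E.
Proof.
move=> p1 intf.
have r0 : r != 0 by rewrite gt_eqF.
have intc : lam.-integrable D (EFin \o cst c).
  apply/integrableP; split; first exact/measurable_EFinP.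
  apply: (@le_lt_trans _ _ (`|c|%:E * lam D)%E); first by rewrite -integral_cst.
  by rewrite lamD -EFinM ltry.
have intg : lam.-integrable D (EFin \o (f \- cst c)).
  by apply: eq_integrable (integrableB mD intf intc).
have mg : measurable_fun D (f \- cst c).
  by have /integrableP[/measurable_EFinP] := intg.
have -> : r^-1 * \int[lam]_(b in D) f b - c =
    r^-1 * \int[lam]_(b in D) (f b - c).
  rewrite RintegralB// Rintegral_cst// lamD/= mulrBr.
  by rewrite [c * r]mulrC mulKf.
pose m := r^-1 * \int[lam]_(b in D) `|f b - c|.
have m0 : 0 <= m.
  by apply: mulr_ge0; [rewrite invr_ge0 ltW|exact: Rintegral_ge0].
have q0 : 0 <= p - 1 by rewrite subr_ge0.
apply: (@le_trans _ _ (m `^ p)%:E).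
  rewrite lee_fin; apply: ge0_ler_powR; rewrite ?nnegrE// ?(le_trans _ p1)//.
  rewrite normrM gtr0_norm ?invr_gt0// ler_pM2l ?invr_gt0//.
  exact: le_normr_Rintegral.
rewrite -lee_pdivrMl ?invr_gt0// invrK -EFinM.
set J := (\int[lam]_(b in D) _)%E.
have mabs : measurable_fun D (fun b => `|f b - c|).
  exact: measurableT_comp.
have mpow : measurable_fun D (fun b => `|f b - c| `^ p).
  exact: (measurableT_comp (measurable_powR p)).
have : (\int[lam]_(b in D) (p * m `^ (p - 1) * `|f b - c|)%:E <=
        \int[lam]_(b in D) (`|f b - c| `^ p + (p - 1) * m `^ p)%:E)%E.
  apply: ge0_le_integral => //.
  - by move=> b _; rewrite lee_fin !mulr_ge0 ?powR_ge0// (le_trans _ p1).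
  - by apply/measurable_EFinP; exact: measurable_funM.
  - by apply/measurable_EFinP; exact: measurable_funD.
  - by move=> b _; rewrite lee_fin powR_tangent.
under eq_integral do rewrite EFinM.
rewrite ge0_integralZl_EFin//; last 2 first.
- exact/measurable_EFinP.
- by rewrite mulr_ge0 ?powR_ge0// (le_trans _ p1).
under [X in (_ <= X)%E]eq_integral do rewrite EFinD.
rewrite ge0_integralD//; last 2 first.
- exact/measurable_EFinP.
- by move=> b _; rewrite lee_fin mulr_ge0 ?powR_ge0.
rewrite -/J [X in (_ <= _ + X)%E]integral_cst// lamD.
have -> : (\int[lam]_(b in D) `|f b - c|%:E = (m * r)%:E)%E.
  rewrite /m mulrAC mulVf// mul1r fineK//.
  by apply: integrable_fin_num => //; exact: (integrable_norm intg).
rewrite -!EFinM -leeBlDr// -EFinB; apply: le_trans; rewrite lee_fin.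
rewrite -(mulr_powRB1 m0 (lt_le_trans ltr01 p1)) le_eqVlt.
by apply/orP; left; apply/eqP; ring.
Qed.

End jensen.

Section section_mean.
Context disp1 disp2 (T : measurableType disp1) (S : measurableType disp2).
Context (R : realType).
Variable mu : {sigma_finite_measure set T -> \bar R}.
Variable lam : {sigma_finite_measure set S -> \bar R}.
Variables (D : set S) (r p : R) (H : T * S -> R).
Hypothesis mD : measurable D.
Hypothesis r_gt0 : 0 < r.
Hypothesis lamD : lam D = r%:E.
Hypothesis p_ge1 : 1 <= p.
Hypothesis mH : measurable_fun setT H.

Definition section_mean (x : T) : R := r^-1 * \int[lam]_(b in D) H (x, b).

Let mTD : measurable ([set: T] `*` D).
Proof. exact: measurableX. Qed.

Let restr_section (Q : T * S -> \bar R) x :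
  (fun b => Q (x, b)) \_ D = (fun b => (Q \_ ([set: T] `*` D)) (x, b)).
Proof. by apply/funext => b; rewrite /patch in_setX in_setT. Qed.

(** Tonelli's theorem yields measurability for nonnegative integrands, so the positive and negative
    parts of [H], extended by [0] off [D], are integrated separately. *)
Lemma measurable_section_mean : measurable_fun setT section_mean.
Proof.
pose k : T * S -> \bar R := (EFin \o H) \_ ([set: T] `*` D).
have mk : measurable_fun setT k.
  by apply/(measurable_restrictT _ mTD)/measurable_funTS/measurable_EFinP.
have -> : section_mean = fun x => r^-1 * fine
    (\int[lam]_b k^\+ (x, b) - \int[lam]_b k^\- (x, b))%E.
  apply/funext => x; rewrite /section_mean /Rintegral integral_mkcond.
  rewrite (restr_section (EFin \o H)) integralE; congr (_ * fine (_ - _)).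
    by apply: eq_integral => b _; rewrite !funeposE.
  by apply: eq_integral => b _; rewrite !funenegE.
apply: measurable_funM => //; apply: measurableT_comp => //.
apply: emeasurable_funB.
  exact: (measurable_fun_fubini_tonelli_F _ (measurable_funepos mk) (funepos_ge0 k)).
exact: (measurable_fun_fubini_tonelli_F _ (measurable_funeneg mk) (funeneg_ge0 k)).
Qed.

Section deviation.
Variables (G : T -> R) (w : R).
Hypothesis mG : measurable_fun setT G.
Hypothesis devw : forall b, D b ->
  (\int[mu]_x (`|H (x, b) - G x| `^ p)%:E <= w%:E)%E.

Let dev (z : T * S) : \bar R := (`|H z - G z.1| `^ p)%:E.

Let mdev : measurable_fun setT dev.
Proof.
apply/measurable_EFinP; apply: (measurableT_comp (measurable_powR p)).
apply: measurableT_comp => //; apply: measurable_funB => //.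
by apply: (measurableT_comp mG); exact: measurable_fst.
Qed.

Let k : T * S -> \bar R := dev \_ ([set: T] `*` D).

Let mk : measurable_fun setT k.
Proof. exact/(measurable_restrictT _ mTD)/measurable_funTS. Qed.

Let k0 z : (0 <= k z)%E.
Proof. by rewrite /k /patch; case: ifP => // _; rewrite lee_fin powR_ge0. Qed.

Let inner x : (\int[lam]_(b in D) (`|H (x, b) - G x| `^ p)%:E =
  \int[lam]_b k (x, b))%E.
Proof. by rewrite integral_mkcond (restr_section dev). Qed.

Lemma measurable_section_deviation : measurable_fun setT
  (fun x => (\int[lam]_(b in D) (`|H (x, b) - G x| `^ p)%:E)%E).
Proof.
rewrite (_ : (fun _ => _) = fun x => (\int[lam]_b k (x, b))%E).
  exact: (measurable_fun_fubini_tonelli_F k mk k0).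
by apply/funext => x; exact: inner.
Qed.

(** Once Tonelli's theorem has swapped the integrals, [devw] bounds the inner one for each [b] in
    [D], a set of measure [r]. *)
Lemma section_deviation_le :
  (\int[mu]_x \int[lam]_(b in D) (`|H (x, b) - G x| `^ p)%:E <= (w * r)%:E)%E.
Proof.
under eq_integral do rewrite inner.
rewrite (fubini_tonelli k mk k0).
have -> : (w * r)%:E = (\int[lam]_(b in D) w%:E)%E.
  by rewrite EFinM -lamD; exact/esym/(integral_cst lam mD w%:E).
rewrite [leRHS]integral_mkcond; apply: ge0_le_integral => //.
- by move=> b _; apply: integral_ge0.
- exact: (measurable_fun_fubini_tonelli_G k mk k0).
- by apply/(measurable_restrictT _ mD).
- move=> b _; rewrite /patch; case: ifPn => [/set_mem Db|nDb].
    apply: le_trans (devw Db); rewrite le_eqVlt; apply/orP; left; apply/eqP.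
    by apply: eq_integral => x _; rewrite /k /patch in_setX in_setT mem_set.
  rewrite integral0_eq// => x _.
  by rewrite /k /patch in_setX in_setT (negbTE nDb).
Qed.

Lemma section_mean_deviation_le :
  {ae mu, forall x, lam.-integrable D (fun b => (H (x, b))%:E)} ->
  (\int[mu]_x (`|section_mean x - G x| `^ p)%:E <= w%:E)%E.
Proof.
move=> aeH.
apply: (@le_trans _ _ (\int[mu]_x ((r^-1)%:E *
    \int[lam]_(b in D) (`|H (x, b) - G x| `^ p)%:E))%E).
  apply: ae_ge0_le_integral => //.
  - apply/measurable_EFinP; apply: (measurableT_comp (measurable_powR p)).
    apply: measurableT_comp => //; apply: measurable_funB => //.
    exact: measurable_section_mean.
  - move=> x _; apply: mule_ge0; first by rewrite lee_fin invr_ge0 ltW.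
    by apply: integral_ge0 => b _; rewrite lee_fin powR_ge0.
  - exact/measurable_funeM/measurable_section_deviation.
  - apply: filterS aeH => x intH _.
    exact: (jensen_mean mD r_gt0 lamD (G x) p_ge1 intH).
rewrite ge0_integralZl_EFin//; last 3 first.
- by move=> x _; apply: integral_ge0 => b _; rewrite lee_fin powR_ge0.
- exact: measurable_section_deviation.
- by rewrite invr_ge0 ltW.
by rewrite lee_pdivrMl// -EFinM mulrC section_deviation_le.
Qed.

End deviation.

(** The deviation bound with [G = 0] makes the integral of [|H|^p] over almost every section finite;
    since [|H| <= 1 + |H|^p] and [D] has finite measure, [H] is integrable there. *)
Lemma ae_section_integrable (w : R) :
  (forall b, D b -> (\int[mu]_x (`|H (x, b)| `^ p)%:E <= w%:E)%E) ->
  {ae mu, forall x, lam.-integrable D (fun b => (H (x, b))%:E)}.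
Proof.
move=> Hw; have p0 : 0 <= p by rewrite (le_trans _ p_ge1).
have Hw0 b : D b -> (\int[mu]_x (`|H (x, b) - cst 0 x| `^ p)%:E <= w%:E)%E.
  by move=> Db; under eq_integral do rewrite subr0; exact: Hw.
have m0 : measurable_fun setT (cst 0 : T -> R) by [].
have mdev := measurable_section_deviation m0.
have : mu.-integrable setT
    (fun x => \int[lam]_(b in D) (`|H (x, b) - cst 0 x| `^ p)%:E)%E.
  apply/integrableP; split => //.
  under eq_integral => x _.
    rewrite gee0_abs; last by apply: integral_ge0 => b _; rewrite lee_fin powR_ge0.
    over.
  by apply: le_lt_trans (section_deviation_le m0 Hw0) _; rewrite ltry.
move=> /(integrable_ae measurableT); apply: filterS => x /(_ I) xfin.
have mHx : measurable_fun D (fun b => H (x, b)).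
  by apply: measurable_funTS; exact: measurable_fun_pair2.
apply/integrableP; split; first exact/measurable_EFinP.
apply: (@le_lt_trans _ _
    (\int[lam]_(b in D) (1%:E + (`|H (x, b) - cst 0 x| `^ p)%:E))%E).
  apply: ge0_le_integral => //.
  - exact/measurableT_comp/measurable_EFinP.
  - apply: emeasurable_funD => //; apply/measurable_EFinP.
    apply: (measurableT_comp (measurable_powR p)); apply: measurableT_comp => //.
    exact: measurable_funB.
  - move=> b _; rewrite -EFinD lee_fin subr0 /=.
    have [h1|/ltW h1] := leP `|H (x, b)| 1.
      by rewrite (le_trans h1)// lerDl powR_ge0.
    by rewrite (le_trans (le1r_powR h1 p_ge1))// lerDr.
rewrite ge0_integralD//; last first.
- apply/measurable_EFinP.
  apply: (measurableT_comp (measurable_powR p)); apply: measurableT_comp => //.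
  exact: measurable_funB.
have -> : (\int[lam]_(b in D) 1%:E = r%:E)%E.
  by rewrite -lamD -[RHS]mul1e; exact: (integral_cst lam mD 1%:E).
rewrite lte_add_pinfty ?ltry//.
by rewrite ltey_eq xfin.
Qed.

End section_mean.

(** * Sections of null sets, and integrands known only almost everywhere *)

Section section_mean_ae.
Context disp1 disp2 (T : measurableType disp1) (S : measurableType disp2).
Context (R : realType).
Variable mu : {sigma_finite_measure set T -> \bar R}.
Variable lam : {sigma_finite_measure set S -> \bar R}.
Variables (D : set S) (r p : R).
Hypothesis mD : measurable D.
Hypothesis r_gt0 : 0 < r.
Hypothesis lamD : lam D = r%:E.
Hypothesis p_ge1 : 1 <= p.

(** This is [section_deviation_le] for the indicator of [Z], with exponent [1], [G = 0] and [w = 0]: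
    a nonnegative integral that vanishes has an integrand null almost everywhere, first in [x] and
    then in [b]. *)
Lemma ae_section_null (Z : set (T * S)) : measurable Z ->
  (forall b, D b -> mu [set x | Z (x, b)] = 0%E) ->
  {ae mu, forall x, {ae lam, forall b, D b -> ~ Z (x, b)}}.
Proof.
move=> mZ Z0.
have m1Z : measurable_fun setT (\1_Z : T * S -> R) by exact: measurable_indic.
have m0 : measurable_fun setT (cst 0 : T -> R) by [].
have dev0 b : D b ->
    (\int[mu]_x (`|\1_Z (x, b) - cst 0 x| `^ 1)%:E <= (0 : R)%:E)%E.
  move=> Db; apply: (@le_trans _ _ (mu [set x | Z (x, b)])); last by rewrite Z0.
  rewrite -[X in (_ <= mu X)%E]setIT -integral_indic//.
    rewrite le_eqVlt; apply/orP; left; apply/eqP; apply: eq_integral => x _.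
    by rewrite subr0 powRr1 ?normr_ge0// ger0_norm.
  rewrite -[X in measurable X]setTI; exact: (pair2_measurable b).
have := section_deviation_le mD lamD m1Z m0 dev0; rewrite mul0r => intZ0.
have mdev := measurable_section_deviation lam 1 mD m1Z m0.
have dev_ge0 x : (0 <= \int[lam]_(b in D) (`|\1_Z (x, b) - cst 0 x| `^ 1)%:E)%E.
  by apply: integral_ge0 => b _; rewrite lee_fin powR_ge0.
have : (\int[mu]_x `|\int[lam]_(b in D) (`|\1_Z (x, b) - cst 0 x| `^ 1)%:E| = 0)%E.
  under eq_integral do rewrite gee0_abs//.
  by apply/eqP; rewrite eq_le intZ0 integral_ge0.
move=> /(ae_eq_integral_abs mu measurableT mdev); apply: filterS => x /(_ I) /= x0.
have mx : measurable_fun D (fun b => (\1_Z (x, b) : R)%:E).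
  by apply/measurable_EFinP/measurable_funTS; exact: measurable_fun_pair2.
have : (\int[lam]_(b in D) `|(\1_Z (x, b) : R)%:E| = 0)%E.
  by rewrite -[RHS]x0; apply: eq_integral => b _; rewrite subr0 powRr1 ?normr_ge0.
move=> /(ae_eq_integral_abs lam mD mx); apply: filterS => b /[apply] /eqP.
by rewrite /= eqe indicE pnatr_eq0 eqb0 => /negP + Zxb; apply; rewrite inE.
Qed.

(* [H'] is only known to agree with the jointly measurable [H] off [Z]; its
   measurability comes from the completeness of [mu] and [lam]. *)
Hypothesis mu_complete : measure_is_complete mu.
Hypothesis lam_complete : measure_is_complete lam.
Variables (H : T * S -> R) (H' : T -> S -> R) (Z : set (T * S)).
Hypothesis mH : measurable_fun setT H.
Hypothesis mZ : measurable Z.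
Hypothesis Z_null : forall b, D b -> mu [set x | Z (x, b)] = 0%E.
Hypothesis HH' : forall x b, ~ Z (x, b) -> H' x b = H (x, b).

Let ae_HH' : {ae mu, forall x, ae_eq lam D
  (fun b => (H (x, b))%:E) (fun b => (H' x b)%:E)}.
Proof.
apply: filterS (ae_section_null mZ Z_null) => x; apply: filterS => b nZ Db.
by rewrite HH'//; exact: nZ.
Qed.

Let mHx x : measurable_fun D (fun b => (H (x, b))%:E).
Proof. by apply/measurable_EFinP/measurable_funTS; exact: measurable_fun_pair2. Qed.

Let mH'x x : ae_eq lam D (fun b => (H (x, b))%:E) (fun b => (H' x b)%:E) ->
  measurable_fun D (fun b => (H' x b)%:E).
Proof. by move=> /(ae_measurable_fun lam_complete); apply. Qed.

Let mean' x : R := r^-1 * \int[lam]_(b in D) H' x b.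

Lemma ae_section_integrable_complete (w : R) :
  (forall b, D b -> (\int[mu]_x (`|H (x, b)| `^ p)%:E <= w%:E)%E) ->
  {ae mu, forall x, lam.-integrable D (fun b => (H' x b)%:E)}.
Proof.
move=> /(ae_section_integrable mD lamD p_ge1 mH).
move: ae_HH'; apply: filterS2 => x HH'x /integrableP[_ intH].
apply/integrableP; split; first exact: mH'x.
rewrite (ge0_ae_eq_integral _ _ _ _ _ (ae_eq_abse (ae_eq_sym HH'x)))//.
- by apply: measurableT_comp => //; exact: mH'x.
- exact: measurableT_comp.
- by move=> b _; exact: abse_ge0.
- by move=> b _; exact: abse_ge0.
Qed.

Let ae_mean' : ae_eq mu setT (EFin \o section_mean lam D r H) (EFin \o mean').
Proof.
move: ae_HH'; apply: filterS => x HH'x _.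
congr (_ * fine _)%:E; apply: ae_eq_integral => //; exact: mH'x.
Qed.

Lemma measurable_section_mean_complete : measurable_fun setT mean'.
Proof.
apply/measurable_EFinP; apply: (ae_measurable_fun mu_complete ae_mean').
exact/measurable_EFinP/measurable_section_mean.
Qed.

Lemma section_mean_deviation_complete_le (G G' : T -> R) (w w' : R) :
  (forall b, D b -> (\int[mu]_x (`|H (x, b)| `^ p)%:E <= w%:E)%E) ->
  measurable_fun setT G -> measurable_fun setT G' ->
  ae_eq mu setT (EFin \o G) (EFin \o G') ->
  (forall b, D b -> (\int[mu]_x (`|H (x, b) - G x| `^ p)%:E <= w'%:E)%E) ->
  (\int[mu]_x (`|mean' x - G' x| `^ p)%:E <= w'%:E)%E.
Proof.
move=> Hw mG mG' GG' HG.
have aeH := ae_section_integrable mD lamD p_ge1 mH Hw.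
apply: le_trans (section_mean_deviation_le mD r_gt0 lamD p_ge1 mH mG HG aeH).
have mdev (f g : T -> R) : measurable_fun setT f -> measurable_fun setT g ->
    measurable_fun setT (fun x => (`|f x - g x| `^ p)%:E).
  move=> mf mg; apply/measurable_EFinP.
  apply: (measurableT_comp (measurable_powR p)).
  by apply: measurableT_comp => //; exact: measurable_funB.
rewrite le_eqVlt; apply/orP; left; apply/eqP; apply: ge0_ae_eq_integral => //.
- by apply: mdev => //; exact: measurable_section_mean_complete.
- by apply: mdev => //; exact: measurable_section_mean.
- move: ae_mean' GG'; apply: filterS2 => x meanx Gx _.
  have [-> ->] : section_mean lam D r H x = mean' x /\ G x = G' x.
    by split; apply: EFin_inj; [exact: meanx|exact: Gx].
  by [].
Qed.

End section_mean_ae.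

Lemma ge0_cvge0 (R : realType) (f : R -> \bar R) (Fl : set_system R) :
  ProperFilter Fl -> (forall t, 0 <= f t)%E ->
  (forall e : R, 0 < e -> \forall t \near Fl, (f t <= e%:E)%E) ->
  f @ Fl --> 0%E.
Proof.
move=> PF f0 fe; apply/fine_cvgP; split.
  apply: filterS (fe 1 ltr01) => t ft1.
  by rewrite ge0_fin_numE// (le_lt_trans ft1) ?ltry.
apply/cvgrPdist_le => e e0; apply: filterS (fe e e0) => t fte.
rewrite sub0r normrN /= ger0_norm ?fine_ge0// -lee_fin fineK//.
by rewrite ge0_fin_numE// (le_lt_trans fte) ?ltry.
Qed.

(** * Directional means *)

Section field_mean.
Context {R : realType} {n : nat}.
Local Notation mu := (@lebesgue_measure_rV R n).
Local Notation rVL := (lebesgue_rV R n).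
Local Notation rVB := (g_sigma_algebraType (@boxes R n)).
Variables (K p : R) (v : 'rV[R]_n -> 'rV[R]_n).
Hypothesis K_gt0 : 0 < K.
Hypothesis lipv : unit_lipschitz_field K v.
Hypothesis p_ge1 : 1 <= p.

Lemma lebesgue_measure_rV_complete : measure_is_complete mu.
Proof. exact: measure_is_complete_caratheodory. Qed.

Lemma measurable_borel_lebesgue (F0 : 'rV[R]_n -> R) :
  measurable_fun setT (F0 : rVB -> R) -> measurable_fun setT (F0 : rVL -> R).
Proof.
move=> mF0 _ A mA; rewrite setTI; apply: sub_boxes_measurable.
by have := mF0 measurableT A mA; rewrite setTI.
Qed.

Lemma flow_Lp_cvg (F : rVL -> R) : measurable_fun setT F ->
  (\int[mu]_x (`|F x| `^ p)%:E < +oo)%E ->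
  forall e : R, 0 < e -> exists2 d : R, 0 < d & forall b, `|b| <= d ->
  (\int[mu]_x (`|F (flow v b x) - F x| `^ p)%:E <= e%:E)%E.
Proof.
pose t0 := (2 * K)^-1.
have t0_gt0 : 0 < t0 by rewrite invr_gt0 mulr_gt0.
have t0K : t0 * K < 1 by rewrite /t0 invfM mulfVK ?gt_eqF//; lra.
have mflow b : `|b| <= t0 -> measurable_fun setT (flow v b : rVL -> rVL).
  by move=> bt; exact: (measurable_flow K_gt0 lipv t0K bt).
have flow_le b : `|b| <= t0 -> forall A : set rVL, measurable A ->
    (mu (flow v b @^-1` A) <= (@flow_const R n K t0)%:E * mu A)%E.
  by move=> bt A _; exact: (lebesgue_outer_flow lipv A t0K bt).
move=> mF Foo e e0.
exact: (comp_Lp_cvg t0_gt0 (flow_const_ge0 t0K) mflow flow_le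
  (flow_defect_cvg K_gt0 lipv) p_ge1 mF Foo e0).
Qed.

Variables (F F0 : 'rV[R]_n -> R) (N : set 'rV[R]_n).
Hypothesis mF : measurable_fun setT (F : rVL -> R).
Hypothesis mF0 : measurable_fun setT (F0 : rVB -> R).
Hypothesis mN : <<s (@boxes R n) >> N.
Hypothesis N0 : lebesgue_outer N = 0%E.
Hypothesis FF0 : forall x, ~ N x -> F x = F0 x.
Variable M : R.
Hypothesis F0I : (\int[mu]_x (`|F0 x| `^ p)%:E <= M%:E)%E.

Context disp (S : measurableType disp).
Variable lam : {sigma_finite_measure set S -> \bar R}.
Variables (D : set S) (t : R) (h : S -> R).
Hypothesis lam_complete : measure_is_complete lam.
Hypothesis mD : measurable D.
Hypothesis t_gt0 : 0 < t.
Hypothesis tK : t * K < 1.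
Hypothesis lamD : lam D = (2 * t)%:E.
Hypothesis mh : measurable_fun setT h.
Hypothesis hD : forall b, D b -> `|h b| <= t.

(** [S] will be the real line with its completed sigma-algebra and [h] the identity into the Borel
    line, so that the two measurable structures on the parameter stay apart. *)
Let H (z : rVL * S) : R := F0 (flow v (h z.2) z.1).
Let Z : set (rVL * S) := [set z | N (flow v (h z.2) z.1)].

Let mH : measurable_fun setT H.
Proof.
exact: (measurableT_comp mF0 (measurable_flow_joint K_gt0 lipv mh)).
Qed.

Let mZ : measurable Z.
Proof.
rewrite -[X in measurable X]setTI.
exact: (measurable_flow_joint K_gt0 lipv mh measurableT mN).
Qed.

Let Z_null b : D b -> mu [set x | Z (x, b)] = 0%E.
Proof.
move=> Db; apply/eqP; rewrite eq_le measure_ge0 andbT.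
by apply: (le_trans (lebesgue_outer_flow lipv N tK (hD Db))); rewrite N0 mule0.
Qed.

Let F' (x : rVL) (b : S) : R := F (flow v (h b) x).

Let HF x b : ~ Z (x, b) -> F' x b = H (x, b).
Proof. exact: FF0. Qed.

Let r_gt0 : 0 < 2 * t. Proof. by rewrite mulr_gt0. Qed.

Let w : R := @flow_const R n K t * M.

Let mF0L : measurable_fun setT (F0 : rVL -> R).
Proof. exact: measurable_borel_lebesgue. Qed.

Let Hw b : D b -> (\int[mu]_x (`|H (x, b)| `^ p)%:E <= w%:E)%E.
Proof.
move=> Db; have mpow : measurable_fun setT (fun x : rVL => (`|F0 x| `^ p)%:E).
  apply/measurable_EFinP; apply: (measurableT_comp (measurable_powR p)).
  exact: measurableT_comp.
have pow0 (x : rVL) : (0 <= (`|F0 x| `^ p)%:E)%E by rewrite lee_fin powR_ge0.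
apply: (le_trans (ge0_integral_flow_le K_gt0 lipv tK (hD Db) mpow pow0)).
by rewrite /w EFinM lee_wpmul2l// lee_fin flow_const_ge0.
Qed.

Let aeF : ae_eq mu setT (EFin \o (F0 : rVL -> R)) (EFin \o F).
Proof.
exists N; split; [exact: sub_boxes_measurable|exact: N0|].
move=> x; apply: contra_notP => nNx _; by rewrite /= FF0.
Qed.

Let mean (x : rVL) : R := (2 * t)^-1 * \int[lam]_(b in D) F (flow v (h b) x).

Lemma field_mean_integrable :
  {ae mu, forall x, lam.-integrable D (fun b => (F (flow v (h b) x))%:E)}.
Proof.
exact: (ae_section_integrable_complete mD lamD p_ge1 lam_complete
  mH mZ Z_null HF Hw).
Qed.

Lemma measurable_field_mean : measurable_fun setT mean.
Proof.
exact: (measurable_section_mean_complete mD lamD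
  lebesgue_measure_rV_complete lam_complete mH mZ Z_null HF).
Qed.

(** Used with [G = G' = 0] for the norm of the mean, and with the Borel [G = F0] and the given
    [G' = F] for its distance to [F]. *)
Lemma field_mean_deviation_le (G G' : rVL -> R) (w' : R) :
  measurable_fun setT G -> measurable_fun setT G' ->
  ae_eq mu setT (EFin \o G) (EFin \o G') ->
  (forall b, D b ->
     (\int[mu]_x (`|F0 (flow v (h b) x) - G x| `^ p)%:E <= w'%:E)%E) ->
  (\int[mu]_x (`|mean x - G' x| `^ p)%:E <= w'%:E)%E.
Proof.
move=> mG mG' GG' HG.
exact: (section_mean_deviation_complete_le mD r_gt0 lamD p_ge1
  lebesgue_measure_rV_complete lam_complete mH mZ Z_null HF Hw mG mG' GG' HG).
Qed.

Lemma field_mean_Lp : (\int[mu]_x (`|mean x| `^ p)%:E <= w%:E)%E.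
Proof.
have m0 : measurable_fun setT (cst 0 : rVL -> R) by exact: measurable_cst.
under eq_integral do rewrite -[mean _]subr0.
apply: (field_mean_deviation_le m0 m0); first exact: ae_eq_refl.
by move=> b Db; under eq_integral do rewrite subr0; exact: Hw.
Qed.

Lemma field_mean_Lp_dist (e : R) :
  (forall b, `|b| <= t ->
     (\int[mu]_x (`|F0 (flow v b x) - F0 x| `^ p)%:E <= e%:E)%E) ->
  (\int[mu]_x (`|mean x - F x| `^ p)%:E <= e%:E)%E.
Proof.
move=> He; apply: (field_mean_deviation_le mF0L mF aeF) => b Db.
exact: He (hD Db).
Qed.

End field_mean.

Lemma completed_lebesgue_measure_itvcc (R : realType) (t : R) : 0 < t ->
  completed_lebesgue_measure `[- t, t] = (2 * t)%:E.
Proof.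
move=> t0; rewrite (_ : completed_lebesgue_measure _ =
  lebesgue_measure (`[- t, t] : set R))//.
rewrite lebesgue_measure_itv/= lte_fin ifT; last by lra.
by rewrite -EFinB opprK mulr_natl.
Qed.

Lemma measurable_completed (R : realType) (A : set R) : measurable A ->
  ((@wlength R idfun)^*%mu).-cara.-measurable A.
Proof. by move=> mA; exact: sub_caratheodory. Qed.

Lemma measurable_completed_id (R : realType) :
  measurable_fun [set: caratheodory_type (@wlength R idfun)^*%mu]
    (idfun : _ -> R).
Proof. by move=> _ A mA; rewrite setTI; exact: measurable_completed. Qed.

(** The integral in [directional_mean] has a real value even where the integrand is not integrable;
    integrability along almost every segment is therefore claimed too, so that no default value
    enters the means. *)
Theorem mainTheorem6 (R : realType) (n : nat) (K p : R)
    (v : 'rV[R]_n -> 'rV[R]_n) (F : 'rV[R]_n -> R) :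
  (1 <= n)%N -> 0 < K -> unit_lipschitz_field K v ->
  1 <= p -> F \in Lfun (lebesgue_measure_rV n) p%:E ->
  (forall t : R, 0 < t < K^-1 ->
     {ae lebesgue_measure_rV n, forall X : 'rV[R]_n,
        completed_lebesgue_measure.-integrable `[- t, t]
          (fun beta : R => (F (X + beta *: v X))%:E)} /\
     directional_mean v t F \in Lfun (lebesgue_measure_rV n) p%:E) /\
  Lnorm (lebesgue_measure_rV n) p%:E
      (fun X => (directional_mean v t F X - F X)%:E)
    @[t --> 0^'+] --> 0%E.
Proof.
move=> _ K_gt0 lipv p_ge1 /andP[/[1!inE]/= mF /[!inE]/= Fp].
have p_gt0 : 0 < p by rewrite (lt_le_trans ltr01).
have pV_neq0 : p^-1 != 0 by rewrite invr_neq0// gt_eqF.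
pose mu := @lebesgue_measure_rV R n.
have LnormE (G : 'rV[R]_n -> R) : Lnorm mu p%:E (fun X => (G X)%:E) =
    ((\int[mu]_x (`|G x| `^ p)%:E) `^ p^-1)%E.
  by rewrite unlock.
have {}Fp : (\int[mu]_x (`|F x| `^ p)%:E < +oo)%E.
  by move: Fp; rewrite /finite_norm LnormE; exact: lty_poweRy.
have [F0 mF0 [N [mN N0 FF0]]] := measurable_fun_ae_borel mF.
have mF0L := measurable_borel_lebesgue mF0.
have mpow (G : lebesgue_rV R n -> R) : measurable_fun setT G ->
    measurable_fun setT (fun x => (`|G x| `^ p)%:E).
  move=> mG; apply/measurable_EFinP; apply: (measurableT_comp (measurable_powR p)).
  exact: measurableT_comp.
have F0p : (\int[mu]_x (`|F0 x| `^ p)%:E < +oo)%E.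
  rewrite (ge0_ae_eq_integral measurableT (mpow _ mF0L) (mpow _ mF))//.
  - exists N; split; [exact: sub_boxes_measurable|exact: N0|].
    by move=> x; apply: contra_notP => nNx _; rewrite /= FF0.
set M := fine (\int[mu]_x (`|F0 x| `^ p)%:E)%E.
have F0M : (\int[mu]_x (`|F0 x| `^ p)%:E <= M%:E)%E.
  rewrite fineK// ge0_fin_numE//; apply: integral_ge0 => x _.
  by rewrite lee_fin powR_ge0.
have mD (t : R) := measurable_completed (measurable_itv `[- t, t]).
have mid := @measurable_completed_id R.
have hD (t b : R) : [set` `[- t, t]] b -> `|b| <= t.
  by rewrite /= in_itv/= ler_norml.
split.
  move=> t /andP[t_gt0 tK].
  have {}tK : t * K < 1 by rewrite -ltr_pdivlMr// div1r.
  split.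
    have := field_mean_integrable K_gt0 lipv p_ge1 mF0 mN N0 FF0 F0M
      completed_lebesgue_measure_is_complete (mD t) tK
      (completed_lebesgue_measure_itvcc t_gt0) mid (hD t).
    exact.
  apply/andP; split; rewrite inE/=.
    exact: (measurable_field_mean K_gt0 lipv mF0 mN N0 FF0
      completed_lebesgue_measure_is_complete (mD t) tK
      (completed_lebesgue_measure_itvcc t_gt0) mid (hD t)).
  rewrite /finite_norm LnormE; apply: poweR_lty.
  apply: le_lt_trans (ltry _).
  exact: (field_mean_Lp K_gt0 lipv p_ge1 mF0 mN N0 FF0 F0M
    completed_lebesgue_measure_is_complete (mD t) t_gt0 tK
    (completed_lebesgue_measure_itvcc t_gt0) mid (hD t)).
apply: ge0_cvge0 => [t|e e0]; first exact: Lnorm_ge0.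
(* The estimates concern the integral of the [p]-th power, so [e ^ p] is the accuracy whose [p]-th
   root is [e]. *)
have ep0 : 0 < e `^ p by rewrite powR_gt0.
have [d d0 hd] := flow_Lp_cvg K_gt0 lipv p_ge1 mF0L F0p ep0.
near=> t.
have t_gt0 : 0 < t by near: t; exact: nbhs_right_gt.
have td : t <= d by near: t; exact: nbhs_right_le.
have tK : t * K < 1.
  rewrite -ltr_pdivlMr// div1r; near: t; apply: nbhs_right_lt.
  by rewrite invr_gt0.
rewrite LnormE.
have -> : e%:E = ((e `^ p)%:E `^ p^-1)%E.
  by rewrite poweR_EFin -powRrM mulfV ?gt_eqF// powRr1// ltW.
apply: gt0_ler_poweR.
- by rewrite invr_ge0 ltW.
- by rewrite in_itv/= leey andbT; apply: integral_ge0 => x _; rewrite lee_fin powR_ge0.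
- by rewrite in_itv/= leey andbT lee_fin powR_ge0.
apply: (field_mean_Lp_dist K_gt0 lipv p_ge1 mF mF0 mN N0 FF0 F0M
    completed_lebesgue_measure_is_complete (mD t) t_gt0 tK
    (completed_lebesgue_measure_itvcc t_gt0) mid (hD t)).
by move=> b bt; apply: hd; exact: le_trans td.
Unshelve. all: by end_near.
Qed.
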